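(* Let $(\mathcal N,J,g)$ be a Kähler manifold of real dimension $2n$ with Kähler form $\omega=d\tau$, and let $\mathcal M=\mathbb R\times\mathcal N$ with structure $(\phi,\xi,\eta,g^L)$ be its Sasakian lift. If $\mathcal N$ is Kähler–Einstein with Einstein constant $c$ (i.e. $Ric=c\,g$, $c$ constant), then $\mathcal M$ is an $\eta$-Einstein manifold, with $$\overline{Ric}=(c-2)\,g^L+(2n-c+2)\,\eta\otimes\eta,$$ where $\overline{Ric}$ is the Ricci tensor of $g^L$. In particular, $\mathcal M$ is Einstein if and only if $c=2n+2$.
   Context: Conventions: $2\,d\theta(X,Y)=X\theta(Y)-Y\theta(X)-\theta([X,Y])$ for a 1-form $\theta$. On a Kähler manifold $(\mathcal N,J,g)$ the Kähler form is $\omega(X,Y)=g(X,JY)$; it is assumed that there is a global 1-form $\tau$ with $\omega=d\tau$. Sasakian lift: $\mathcal M=\mathbb R\times\mathcal N$ with projection $\pi_2:\mathcal M\to\mathcal N$ and coordinate $t$ on $\mathbb R$; $\xi=\partial_t$, $\eta=dt+\pi_2^*\tau$. A vector field $X$ on $\mathcal N$ is lifted to $X^L=X-(\tau(X)\circ\pi_2)\,\xi$ on $\mathcal M$. The $(1,1)$-tensor $\phi$ and metric $g^L$ are determined by $\phi X^L=(JX)^L$, $\phi\xi=0$, $g^L=\eta\otimes\eta+\pi_2^*g$. An almost contact metric manifold is $\eta$-Einstein if its Ricci tensor is of the form $a\,g+b\,\eta\otimes\eta$. *)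

(* Defs.v *)
From HB Require Import structures.
From mathcomp Require Import all_boot all_order all_algebra.
From mathcomp Require Import all_classical all_reals all_analysis.

Set Implicit Arguments.
Unset Strict Implicit.
Unset Printing Implicit Defensive.

Import Order.TTheory GRing.Theory Num.Theory numFieldNormedType.Exports.

Local Open Scope classical_set_scope.
Local Open Scope ring_scope.

(* Tangent vectors and 1-forms at a point are rows of components in a chart.
   A (1,1)-tensor with matrix A acts by  X |-> X *m A;  a covariant 2-tensor
   with matrix G is  (X, Y) |-> X *m G *m Y^T;  theta(X) is  X *m theta^T.  *)

Section smooth_functions.
Context {R : realType} {m : nat}.

Fixpoint Ck (k : nat) (U : set 'rV[R]_m) (f : 'rV[R]_m -> R) : Prop :=
  (forall x, U x -> {for x, continuous f}) /\
  if k is k'.+1 then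
    forall a : 'I_m,
      (forall x, U x -> derivable f x ('e_a)) /\
      Ck k' U (fun x => 'D_('e_a) f x)
  else True.

Definition smooth (U : set 'rV[R]_m) (f : 'rV[R]_m -> R) : Prop :=
  forall k, Ck k U f.

End smooth_functions.

(* The atlas need not be maximal.  [chartV i] is the inverse of [chart i] on
   the open set [chart i @` dom i]; its values elsewhere are irrelevant. *)
Record manifold (R : realType) (m : nat) := Manifold {
  pts :> topologicalType;
  atlas : Type;
  dom : atlas -> set pts;
  chart : atlas -> pts -> 'rV[R]_m;
  chartV : atlas -> 'rV[R]_m -> pts;
  manifold_nonempty : [set: pts] !=set0;
  manifold_hausdorff : hausdorff_space pts;
  manifold_second_countable : @second_countable pts;
  dom_open : forall i, open (dom i);
  dom_cover : forall p, exists i, dom i p;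
  chart_open : forall i, open (chart i @` dom i);
  chartK : forall i p, dom i p -> chartV i (chart i p) = p;
  chart_continuous : forall i p, dom i p -> {for p, continuous (chart i)};
  chartV_continuous : forall i x, (chart i @` dom i) x ->
    {for x, continuous (chartV i)};
  transition_smooth : forall i j (b : 'I_m),
    smooth (chart i @` (dom i `&` dom j))
      (fun x => chart j (chartV i x) 0 b)
}.

Arguments dom {R m} N i : rename.
Arguments chart {R m} N i p : rename.
Arguments chartV {R m} N i x : rename.

Section tensor_calculus.
Context {R : realType} {m : nat} (N : manifold R m).
Implicit Types (i j : atlas N) (p : N) (a b k : 'I_m).

Definition smooth_on i (f : N -> R) : Prop :=
  smooth (chart N i @` dom N i) (f \o chartV N i).

Definition smooth_fun (f : N -> R) : Prop := forall i, smooth_on i f.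

Definition pd i a (f : N -> R) : N -> R :=
  fun p => 'D_('e_a) (f \o chartV N i) (chart N i p).

Definition jac i j p : 'M[R]_m :=
  \matrix_(a, b) pd i a (fun q => chart N j q 0 b) p.

(* Fields on N, given by their components in every chart. *)
Definition rfield := atlas N -> N -> 'rV[R]_m.
Definition mfield := atlas N -> N -> 'M[R]_m.

Definition is_vector_field (X : rfield) : Prop :=
  (forall i b, smooth_on i (fun p => X i p 0 b)) /\
  (forall i j p, dom N i p -> dom N j p -> X j p = X i p *m jac i j p).

Definition is_one_form (theta : rfield) : Prop :=
  (forall i b, smooth_on i (fun p => theta i p 0 b)) /\
  (forall i j p, dom N i p -> dom N j p ->
     theta i p = theta j p *m (jac i j p)^T).

Definition is_tensor11 (A : mfield) : Prop :=
  (forall i a b, smooth_on i (fun p => A i p a b)) /\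
  (forall i j p, dom N i p -> dom N j p ->
     A i p *m jac i j p = jac i j p *m A j p).

Definition is_tensor02 (G : mfield) : Prop :=
  (forall i a b, smooth_on i (fun p => G i p a b)) /\
  (forall i j p, dom N i p -> dom N j p ->
     G i p = jac i j p *m G j p *m (jac i j p)^T).

Definition is_metric (g : mfield) : Prop :=
  is_tensor02 g /\
  (forall i p, dom N i p ->
     (g i p)^T = g i p /\
     (forall v : 'rV[R]_m, v != 0 -> 0 < (v *m g i p *m v^T) 0 0)).

(* Local vector fields on the domain of a chart i, by components in i. *)
Definition lfield := N -> 'rV[R]_m.

Definition smooth_lfield i (X : lfield) : Prop :=
  forall b, smooth_on i (fun p => X p 0 b).

Definition coord_field a : lfield := fun=> 'e_a.

Definition vder i (X : lfield) (f : N -> R) : N -> R :=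
  fun p => \sum_a X p 0 a * pd i a f p.

Definition lie i (X Y : lfield) : lfield :=
  fun p => \row_b (vder i X (fun q => Y q 0 b) p -
                   vder i Y (fun q => X q 0 b) p).

Definition app11 i (A : mfield) (X : lfield) : lfield :=
  fun p => X p *m A i p.

Definition app1 i (theta : rfield) (X : lfield) : N -> R :=
  fun p => (X p *m (theta i p)^T) 0 0.

Definition app2 i (G : mfield) (X Y : lfield) : N -> R :=
  fun p => (X p *m G i p *m (Y p)^T) 0 0.

(* Omega = d theta, with the normalisation
   2 d theta(X, Y) = X theta(Y) - Y theta(X) - theta([X, Y]). *)
Definition is_ext_d (theta : rfield) (Omega : mfield) : Prop :=
  forall i (X Y : lfield), smooth_lfield i X -> smooth_lfield i Y ->
  forall p, dom N i p ->
    2 * app2 i Omega X Y p =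
      vder i X (app1 i theta Y) p - vder i Y (app1 i theta X) p
      - app1 i theta (lie i X Y) p.

Definition closed2 (Omega : mfield) : Prop :=
  forall i (X Y Z : lfield),
    smooth_lfield i X -> smooth_lfield i Y -> smooth_lfield i Z ->
  forall p, dom N i p ->
    vder i X (app2 i Omega Y Z) p + vder i Y (app2 i Omega Z X) p
    + vder i Z (app2 i Omega X Y) p
    - app2 i Omega (lie i X Y) Z p - app2 i Omega (lie i Y Z) X p
    - app2 i Omega (lie i Z X) Y p = 0.

(* Vanishing of the Nijenhuis tensor. *)
Definition integrable (J : mfield) : Prop :=
  forall i (X Y : lfield), smooth_lfield i X -> smooth_lfield i Y ->
  forall p, dom N i p ->
    lie i (app11 i J X) (app11 i J Y) p
    - app11 i J (lie i (app11 i J X) Y) p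
    - app11 i J (lie i X (app11 i J Y)) p
    - lie i X Y p = 0.

(* omega(X, Y) = g(X, JY) *)
Definition kahler_form (J g : mfield) : mfield :=
  fun i p => g i p *m (J i p)^T.

Definition is_kahler (J g : mfield) : Prop :=
  [/\ is_metric g,
      is_tensor11 J,
      (forall i p, dom N i p ->
         J i p *m J i p = - 1%:M /\ J i p *m g i p *m (J i p)^T = g i p),
      integrable J
    & closed2 (kahler_form J g)].

(* Levi-Civita connection: nabla_{d_a} d_b = \sum_k christoffel a b k d_k. *)
Definition christoffel (g : mfield) i a b k : N -> R :=
  fun p => 2^-1 * \sum_l invmx (g i p) k l *
    (pd i a (fun q => g i q b l) p + pd i b (fun q => g i q a l) p
     - pd i l (fun q => g i q a b) p).

Definition nabla (g : mfield) i (X Y : lfield) : lfield :=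
  fun p => \row_k (vder i X (fun q => Y q 0 k) p +
    \sum_a \sum_b X p 0 a * Y p 0 b * christoffel g i a b k p).

Definition curv (g : mfield) i (X Y Z : lfield) : lfield :=
  fun p => nabla g i X (nabla g i Y Z) p - nabla g i Y (nabla g i X Z) p
           - nabla g i (lie i X Y) Z p.

(* Ric(Y, Z) is the trace of X |-> R(X, Y)Z. *)
Definition ricci (g : mfield) : mfield :=
  fun i p => \matrix_(a, b)
    \sum_k curv g i (coord_field k) (coord_field a) (coord_field b) p 0 k.

Definition einstein_with (g : mfield) (c : R) : Prop :=
  forall i p, dom N i p -> ricci g i p = c *: g i p.

Definition is_einstein (g : mfield) : Prop := exists c, einstein_with g c.

(* phi^2 = - id + eta (x) xi,  eta(xi) = 1,
   g(phi X, phi Y) = g(X, Y) - eta(X) eta(Y) *)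
Definition is_almost_contact_metric (phi : mfield) (xi eta : rfield)
    (g : mfield) : Prop :=
  [/\ is_tensor11 phi, is_vector_field xi, is_one_form eta, is_metric g
    & forall i p, dom N i p ->
      [/\ phi i p *m phi i p = - 1%:M + (eta i p)^T *m xi i p,
          xi i p *m (eta i p)^T = 1%:M
        & phi i p *m g i p *m (phi i p)^T =
          g i p - (eta i p)^T *m eta i p]].

Definition is_eta_einstein (phi : mfield) (xi eta : rfield)
    (g : mfield) : Prop :=
  is_almost_contact_metric phi xi eta g /\
  exists a b : N -> R, [/\ smooth_fun a, smooth_fun b &
    forall i p, dom N i p ->
      ricci g i p = a p *: g i p + b p *: ((eta i p)^T *m eta i p)].

End tensor_calculus.

Arguments rfield {R m} N.
Arguments mfield {R m} N.
Arguments lfield {R m} N.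

Section line_times_manifold.
Context {R : realType}.

Lemma Ck_cst m k (U : set 'rV[R]_m) (c : R) : Ck k U (fun=> c).
Proof.
elim: k c => [|k IH] c /=; split=> //; try by move=> x _; exact: cst_continuous.
move=> a; split=> [x _|]; first exact: derivable_cst.
have -> : (fun x : 'rV[R]_m => 'D_(delta_mx 0 a) (fun=> c) x) = fun=> (0 : R).
  by apply/funext => x; rewrite (derive_cst c).
exact: IH.
Qed.

Lemma cvg_entries (T : Type) (F : set_system T) {FF : Filter F} p q
    (f : T -> 'M[R]_(p, q)) (M : 'M[R]_(p, q)) :
  (forall i j, (fun x => f x i j) @ F --> M i j) -> f @ F --> M.
Proof.
move=> cf A [P MP sPA]; apply: (filterS (P := fun x => forall i j, P i j (f x i j))).
  by move=> x; exact: sPA.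
apply: filter_forall => i; apply: filter_forall => j.
exact: (cf i j _ (MP i j)).
Qed.

Lemma rsubmx_continuous m : continuous (@rsubmx R 1 1 m).
Proof.
move=> x; apply: (@cvg_entries _ (nbhs x)) => i j; rewrite mxE.
have -> : (fun y : 'rV[R]_(1 + m) => rsubmx y i j) = fun y => y i (rshift 1 j).
  by apply/funext => y; rewrite mxE.
exact: coord_continuous.
Qed.

Lemma quotient_rsubmx m (f : 'rV[R]_m -> R) (x v : 'rV[R]_(1 + m)) :
  (fun h : R => h^-1 *: (((f \o rsubmx) \o shift x) (h *: v) -
                         (f \o rsubmx) x)) =
  (fun h : R => h^-1 *: ((f \o shift (rsubmx x)) (h *: rsubmx v) -
                         f (rsubmx x))).
Proof.
apply/funext => h /=; congr (_ *: (f _ - _)).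
by apply/rowP => j; rewrite !mxE.
Qed.

Lemma derive_rsubmx m (f : 'rV[R]_m -> R) (x v : 'rV[R]_(1 + m)) :
  'D_v (f \o rsubmx) x = 'D_(rsubmx v) f (rsubmx x).
Proof. by rewrite /derive quotient_rsubmx. Qed.

Lemma derivable_rsubmx m (f : 'rV[R]_m -> R) (x v : 'rV[R]_(1 + m)) :
  derivable f (rsubmx x) (rsubmx v) -> derivable (f \o rsubmx) x v.
Proof. by rewrite /derivable quotient_rsubmx. Qed.

Lemma rsubmx_delta_l m (a : 'I_1) :
  rsubmx (delta_mx 0 (lshift m a) : 'rV[R]_(1 + m)) = 0.
Proof. by apply/rowP => j; rewrite !mxE eq_rlshift andbF. Qed.

Lemma rsubmx_delta_r m (a : 'I_m) :
  rsubmx (delta_mx 0 (rshift 1 a) : 'rV[R]_(1 + m)) = delta_mx 0 a.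
Proof. by apply/rowP => j; rewrite !mxE eq_rshift. Qed.

Lemma derive_dir0 m (f : 'rV[R]_m -> R) x :
  derivable f x 0 /\ 'D_0 f x = 0.
Proof.
have E : (fun h : R => h^-1 *: ((f \o shift x) (h *: 0) - f x)) = fun=> 0.
  by apply/funext => h /=; rewrite scaler0 add0r subrr scaler0.
rewrite /derivable /derive E; split; first exact: is_cvg_cst.
exact: lim_cst.
Qed.

Lemma Ck_rsubmx m k (U : set 'rV[R]_m) f : Ck k U f ->
  Ck k [set x : 'rV[R]_(1 + m) | U (rsubmx x)] (f \o rsubmx).
Proof.
have C (f' : 'rV[R]_m -> R) : (forall x, U x -> {for x, continuous f'}) ->
    forall x : 'rV[R]_(1 + m), U (rsubmx x) ->
    {for x, continuous (f' \o rsubmx)}.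
  move=> cf x Ux A /(cf _ Ux) fA.
  by have := @rsubmx_continuous m x _ fA.
elim: k f => [|k IH] f /= [cf df]; split=> //; try exact: C.
move=> a; case: (split_ordP a) => b ->.
  split=> [x _|]; first by apply: derivable_rsubmx;
    rewrite rsubmx_delta_l; exact: (derive_dir0 _ _).1.
  set g := (fun x : 'rV[R]_(1 + m) => 'D_ _ _ x); have -> : g = fun=> (0 : R).
    by apply/funext => x; rewrite /g derive_rsubmx rsubmx_delta_l (derive_dir0 _ _).2.
  exact: Ck_cst.
have [db cb] := df b; split=> [x Ux|].
  by apply: derivable_rsubmx; rewrite rsubmx_delta_r; exact: db.
set g := (fun x : 'rV[R]_(1 + m) => 'D_ _ _ x).
have -> : g = (fun x => 'D_(delta_mx 0 b) f x) \o rsubmx.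
  by apply/funext => x; rewrite /g derive_rsubmx rsubmx_delta_r.
exact: IH.
Qed.

Lemma Ck_coord m k (U : set 'rV[R]_m) (c : 'I_m) : Ck k U (fun x => x 0 c).
Proof.
have C x : {for x, continuous (fun y : 'rV[R]_m => y 0 c)}.
  exact: coord_continuous.
case: k => [|k] /=; split=> // a.
have D (x : 'rV[R]_m) : is_derive x (delta_mx 0 a) (fun y : 'rV[R]_m => y 0 c)
    ((a == c)%:R : R).
  have E : (fun h : R => h^-1 *: (((fun y : 'rV[R]_m => y 0 c) \o shift x)
      (h *: delta_mx 0 a) - x 0 c)) @ 0^' --> ((a == c)%:R : R).
    apply: (@cvg_trans _ (((fun=> (a == c)%:R) : R -> R) @ 0^')); last exact: cvg_cst.
    apply: near_eq_cvg; near=> h => /=.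
    have h0 : h != 0 by near: h; exact: nbhs_dnbhs_neq.
    by rewrite !mxE eqxx /= addrK eq_sym /GRing.scale /= mulKf.
  split; first by apply/cvg_ex; exists (a == c)%:R.
  exact: (cvg_lim _ E).
split=> [x _|]; first exact: ex_derive.
have -> : (fun x : 'rV[R]_m => 'D_(delta_mx 0 a) (fun y : 'rV[R]_m => y 0 c) x) =
    fun=> (a == c)%:R.
  by apply/funext => x; rewrite derive_val.
exact: Ck_cst.
Unshelve. all: by end_near. Qed.

Lemma open_prod (T T' : topologicalType) (A : set T) (B : set T') :
  open A -> open B -> open (A `*` B).
Proof.
rewrite !openE => oA oB [x y] [/= Ax By].
by exists (A, B) => //; split; [exact: oA|exact: oB].
Qed.

Lemma second_countable_prod (T T' : topologicalType) :
  @second_countable T -> @second_countable T' ->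
  @second_countable (T * T')%type.
Proof.
move=> [B cB [oB bB]] [C cC [oC bC]].
exists ((fun X : set T * set T' => X.1 `*` X.2) @` (B `*` C)).
  by apply: sub_countable (card_image_le _ _) _; exact: countableX.
split=> [_ [[X Y] [/= BX CY] <-]|[x y] A [[P Q] [/= xP yQ] PQA]].
  by apply: open_prod; [exact: oB|exact: oC].
have [X [BX Xx] XP] := bB x _ xP; have [Y [CY Yy] YQ] := bC y _ yQ.
exists (X `*` Y); first by split; [exists (X, Y)|split].
by move=> [s t] [/= Xs Yt]; apply: PQA; split; [exact: XP|exact: YQ].
Qed.

Lemma second_countable_line : @second_countable R.
Proof.
pose f (q : rat * rat) : set R := [set x | ratr q.1 < x < ratr q.2].
exists (range f).
  by apply: sub_countable (card_image_le _ _) _; exact: countableP.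
have of_ q : open (f q).
  have -> : f q = `]ratr q.1, ratr q.2[%classic.
    by apply/seteqP; split=> x; rewrite /f /= in_itv.
  exact: interval_open.
split=> [_ [q _ <-]//|x A /nbhs_ballP[e /= e0 xA]].
have /rat_in_itvoo[p] : x - e < x by rewrite ltrBlDr ltrDl.
have /rat_in_itvoo[q] : x < x + e by rewrite ltrDl.
rewrite !in_itv /= => /andP[xq qe] /andP[ep px].
exists (f (p, q)); first by split; [exists (p, q)|rewrite /f /= px xq].
move=> y /= /andP[py yq]; apply: xA; rewrite /ball /= ltr_distlC.
by rewrite (lt_trans ep py) (lt_trans yq qe).
Qed.

End line_times_manifold.

Section product_manifold.
Context {R : realType} {m : nat} (N : manifold R m).
Let M : topologicalType := (R * N)%type.

Definition line_dom (i : atlas N) : set M := [set p | dom N i p.2].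

Definition line_chart (i : atlas N) (p : M) : 'rV[R]_(1 + m) :=
  row_mx p.1%:M (chart N i p.2).

Definition line_chartV (i : atlas N) (x : 'rV[R]_(1 + m)) : M :=
  (lsubmx x 0 0, chartV N i (rsubmx x)).

Lemma line_image i (A : set N) :
  line_chart i @` [set p : M | A p.2] =
  [set x | (chart N i @` A) (rsubmx x)].
Proof.
apply/seteqP; split=> [_ [[t p] /= Ap <-]|x [p Ap E]] /=.
  by rewrite row_mxKr; exists p.
exists (lsubmx x 0 0, p) => //.
rewrite /line_chart /= E -[RHS]hsubmxK; congr row_mx.
by apply/rowP => a; rewrite ord1 mxE eqxx mulr1n.
Qed.

Lemma line_nonempty : [set: M] !=set0.
Proof. by have [p _] := manifold_nonempty N; exists (0, p). Qed.

Lemma line_hausdorff : hausdorff_space M.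
Proof.
move=> [s p] [t q] pq; congr (_, _).
  apply: (@Rhausdorff R) => A B sA tB.
  have [[u r] [/= Au Bu]] : (fst @^-1` A : set M) `&` fst @^-1` B !=set0.
    by apply: pq; apply: cvg_fst.
  by exists u.
apply: (@manifold_hausdorff _ _ N) => A B sA tB.
have [[u r] [/= Au Bu]] : (snd @^-1` A : set M) `&` snd @^-1` B !=set0.
  by apply: pq; apply: cvg_snd.
by exists r.
Qed.

Lemma line_second_countable : @second_countable M.
Proof.
by apply: second_countable_prod;
  [exact: second_countable_line|exact: manifold_second_countable].
Qed.

Lemma line_dom_open i : open (line_dom i).
Proof.
have -> : line_dom i = setT `*` dom N i by apply/seteqP; split=> p // [].
by apply: open_prod; [exact: openT|exact: dom_open].
Qed.

Lemma line_dom_cover p : exists i, line_dom i p.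
Proof. exact: dom_cover. Qed.

Lemma line_chart_open i : open (line_chart i @` line_dom i).
Proof.
rewrite line_image.
by have /continuousP := @rsubmx_continuous R m; apply; exact: chart_open.
Qed.

Lemma line_chartK i p : line_dom i p -> line_chartV i (line_chart i p) = p.
Proof.
case: p => t p /= ip.
by rewrite /line_chartV /line_chart row_mxKl row_mxKr /= chartK // mxE eqxx.
Qed.

Lemma line_chart_continuous i p :
  line_dom i p -> {for p, continuous (line_chart i)}.
Proof.
case: p => t p /= ip; apply: (@cvg_entries _ _ (nbhs (t, p))) => a b.
rewrite ord1 {a}; case: (split_ordP b) => c ->.
  rewrite row_mxEl ord1 mxE eqxx mulr1n.
  have -> : (fun x : M => line_chart i x 0 (lshift m 0)) = fst.
    by apply/funext => x; rewrite /line_chart row_mxEl mxE eqxx.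
  exact: cvg_fst.
rewrite row_mxEr /=.
have -> : (fun x : M => line_chart i x 0 (rshift 1 c)) =
    (fun x => chart N i x 0 c) \o snd.
  by apply/funext => x; rewrite /line_chart row_mxEr.
have cs : (fun x : M => x.2) @ (nbhs t, nbhs p) --> p by exact: cvg_snd.
move=> A nA.
exact: (cs _ (chart_continuous ip (coord_continuous nA))).
Qed.

Lemma line_chartV_continuous i x : (line_chart i @` line_dom i) x ->
  {for x, continuous (line_chartV i)}.
Proof.
rewrite line_image => ix.
have c1 : (fun y : 'rV[R]_(1 + m) => lsubmx y 0 0) @ x --> (lsubmx x 0 0 : R).
  have -> : (fun y : 'rV[R]_(1 + m) => lsubmx y 0 0) =
      fun y => y 0 (lshift m 0) by apply/funext => y; rewrite mxE.
  by rewrite mxE; exact: coord_continuous.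
have c2 : (fun y => chartV N i (rsubmx y)) @ x --> chartV N i (rsubmx x).
  move=> A nA; exact: (@rsubmx_continuous R m x _ (chartV_continuous ix nA)).
exact: (cvg_pair c1 c2).
Qed.

Lemma line_transition_smooth i j (b : 'I_(1 + m)) :
  smooth (line_chart i @` (line_dom i `&` line_dom j))
    (fun x => line_chart j (line_chartV i x) 0 b).
Proof.
move=> k; case: (split_ordP b) => c ->.
  rewrite (ord1 c).
  have -> : (fun x => line_chart j (line_chartV i x) 0 (lshift m 0)) =
      fun x => x 0 (lshift m 0).
    by apply/funext => x; rewrite /line_chart row_mxEl !mxE eqxx mulr1n /= mxE.
  exact: Ck_coord.
have -> : (fun x => line_chart j (line_chartV i x) 0 (rshift 1 c)) =
    (fun x => chart N j (chartV N i x) 0 c) \o rsubmx.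
  by apply/funext => x; rewrite /line_chart row_mxEr.
rewrite (line_image i (dom N i `&` dom N j)).
exact/Ck_rsubmx/transition_smooth.
Qed.

(* R x N, with the charts (t, p) |-> (t, chart i p). *)
Definition line_manifold : manifold R (1 + m) :=
  Manifold line_nonempty line_hausdorff line_second_countable
    line_dom_open line_dom_cover line_chart_open line_chartK
    line_chart_continuous line_chartV_continuous line_transition_smooth.

End product_manifold.

Section sasakian_lift.
Context {R : realType} {m : nat} (N : manifold R m).
Variables (J g : mfield N) (tau : rfield N).
Let M := line_manifold N.

(* Matrix of the differential of pi_2, X |-> X *m dpi2. *)
Definition dpi2 : 'M[R]_(1 + m, m) := col_mx 0 1%:M.

Definition lift_xi : rfield M := fun _ _ => row_mx 1%:M 0.

(* eta = dt + pi_2^* tau *)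
Definition lift_eta : rfield M :=
  fun i p => row_mx 1%:M 0 + tau i p.2 *m dpi2^T.

(* Matrix of X |-> X^L = (0, X) - tau(X) xi. *)
Definition lift_mx (i : atlas N) (q : N) : 'M[R]_(m, 1 + m) :=
  row_mx 0 1%:M - (tau i q)^T *m row_mx 1%:M 0.

(* phi Z = (J (d pi_2 Z))^L *)
Definition lift_phi : mfield M :=
  fun i p => dpi2 *m J i p.2 *m lift_mx i p.2.

(* g^L = eta (x) eta + pi_2^* g *)
Definition lift_metric : mfield M :=
  fun i p => (lift_eta i p)^T *m lift_eta i p + dpi2 *m g i p.2 *m dpi2^T.

Lemma lift_mxE i (q : N) (X : 'rV[R]_m) :
  X *m lift_mx i q =
  row_mx 0 X - (X *m (tau i q)^T) 0 0 *: row_mx 1%:M 0.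
Proof.
rewrite /lift_mx mulmxBr mul_mx_row mulmx0 mulmx1 mulmxA.
by rewrite {1}(mx11_scalar (X *m (tau i q)^T)) mul_scalar_mx.
Qed.

Lemma lift_phi_lift i (p : M) (X : 'rV[R]_m) :
  X *m lift_mx i p.2 *m lift_phi i p = (X *m J i p.2) *m lift_mx i p.2.
Proof.
have LP : lift_mx i p.2 *m dpi2 = 1%:M.
  by rewrite /lift_mx /dpi2 mulmxBl -mulmxA !mul_row_col !mulmx0 !mul0mx
             mulmx1 addr0 add0r mulmx0 subr0.
by rewrite /lift_phi !mulmxA -(mulmxA X) LP mulmx1.
Qed.

Lemma lift_phi_xi i (p : M) : lift_xi i p *m lift_phi i p = 0.
Proof.
by rewrite /lift_phi /dpi2 !mulmxA mul_row_col mulmx0 mul0mx addr0 !mul0mx.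
Qed.

End sasakian_lift.

Arguments lift_xi {R m} N.

(* Main.v *)
Require Import Defs.
From HB Require Import structures.
From mathcomp Require Import all_boot all_order all_algebra.
From mathcomp Require Import all_classical all_reals all_analysis.
From mathcomp Require Import ring lra.

Set Implicit Arguments.
Unset Strict Implicit.
Unset Printing Implicit Defensive.

Import Order.TTheory GRing.Theory Num.Theory numFieldNormedType.Exports.

Local Open Scope classical_set_scope.
Local Open Scope ring_scope.

(* In a chart, index 0 being t, write t_a for the components of tau, so that
   G = g^L has the blocks [[1, t], [t^T, g + t^T t]].  Since the derivative of
   tau is 2 omega and omega_b^k = - J_b^k, the Christoffel symbols of G are
     G^0_00 = G^k_00 = 0,    G^k_0b = - J_b^k,    G^0_0b = t_k J_b^k,
     G^k_ab = Gamma^k_ab - t_b J_a^k - t_a J_b^k,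
     G^0_ab = (d_a t_b + d_b t_a) / 2 - t_k G^k_ab.
   In the coordinate formula for the Ricci tensor everything but g, J and t
   cancels except a divergence of J, and that divergence vanishes: contract
   d omega = 0 with omega and use that nabla J anticommutes with J.  This gives
   Ric(G)_00 = 2n, Ric(G)_0b = 2n t_b and
   Ric(G)_ab = Ric(g)_ab - 2 g_ab + 2n t_a t_b. *)

(** * Calculus in charts *)

(** The constants have these origins. The convention for d theta makes the antisymmetric half of the
    derivative of tau equal to omega, so J enters the symbols with coefficient 1. The value 2n is -
    tr(J^2). The term - 2 g comes from the divergence terms - d_k (t_b J_a^k + t_a J_b^k): in each,
    the antisymmetric half of d_k t contracts with J to g, while the symmetric half cancels against
    products containing G^0_ab.

    Since det G = det g, the traces G^C_Cb of the symbols are those of g, and G^C_C0 = 0. The Ricci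
    formula is therefore arranged around these traces.

    The obstacle is to keep analysis out of the long cancellations: the formulas for the symbols
    hold only on chart domains, and differentiating them requires the inverse metric to be
    differentiable. Hence all derivatives are evaluated beforehand, and the cancellations are proved
    for finite families of scalars, in which the derivatives of tau, J and the Christoffel symbols
    are plain variables. *)

Section smooth_functions_theory.
Context {R : realType} {m : nat}.
Implicit Types (U : set 'rV[R]_m) (f h : 'rV[R]_m -> R).

Lemma open_near_eq U f h x : open U -> (forall y, U y -> f y = h y) -> U x ->
  {near x, f =1 h}.
Proof. by move=> oU fh Ux; apply: filterS (open_nbhs_nbhs (conj oU Ux)). Qed.

Lemma continuous_for_ext U f h x : open U -> (forall y, U y -> f y = h y) ->
  U x -> {for x, continuous f} -> {for x, continuous h}.
Proof.
move=> oU fh Ux cf; have fhx := fh x Ux.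
have {}cf : f @ x --> h x by rewrite -fhx.
exact: cvg_trans (near_eq_cvg (open_near_eq oU fh Ux)) cf.
Qed.

Lemma Ck_ext k U f h : open U -> (forall x, U x -> f x = h x) ->
  Ck k U f -> Ck k U h.
Proof.
move=> oU; elim: k f h => [|k IH] f h fh /= [cf df].
  by split=> // x Ux; exact: continuous_for_ext oU fh Ux (cf x Ux).
split=> [x Ux|a]; first exact: continuous_for_ext oU fh Ux (cf x Ux).
have [dfa cfa] := df a; split=> [x Ux|].
  by apply: near_eq_derivable (dfa x Ux); exact: open_near_eq oU fh Ux.
apply: IH cfa => x Ux.
by apply: near_eq_derive; exact: open_near_eq oU fh Ux.
Qed.

Lemma CkS k U f : Ck k.+1 U f -> Ck k U f.
Proof.
elim: k f => [|k IH] f [cf df]; split=> // a.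
by have [dfa cfa] := df a; split=> //; exact: IH.
Qed.

Lemma CkD k U f h : open U -> Ck k U f -> Ck k U h ->
  Ck k U (fun x => f x + h x).
Proof.
move=> oU; elim: k f h => [|k IH] f h [cf df] [ch dh].
  by split=> // x Ux; exact: cvgD (cf x Ux) (ch x Ux).
split=> [x Ux|a]; first by exact: cvgD (cf x Ux) (ch x Ux).
 have [dfa cfa] := df a; have [dha cha] := dh a.
split=> [x Ux|]; first by apply: derivableD; [exact: dfa|exact: dha].
apply: (Ck_ext oU _ (IH _ _ cfa cha)) => x Ux.
by rewrite -deriveD; [|exact: dfa|exact: dha].
Qed.

Lemma CkM k U f h : open U -> Ck k U f -> Ck k U h ->
  Ck k U (fun x => f x * h x).
Proof.
move=> oU; elim: k f h => [|k IH] f h Cf Ch.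
  case: Cf => cf _; case: Ch => ch _; split=> // x Ux.
  exact: cvgM (cf x Ux) (ch x Ux).
have [cf df] := Cf; have [ch dh] := Ch; split=> [x Ux|a].
  exact: cvgM (cf x Ux) (ch x Ux).
 have [dfa cfa] := df a; have [dha cha] := dh a.
split=> [x Ux|]; first by apply: derivableM; [exact: dfa|exact: dha].
(* The product rule leaves [f] and [h] undifferentiated beside a derivative, so the induction needs
   them one order lower; [CkS] supplies this. *)
apply: (Ck_ext oU _
  (CkD oU (IH _ _ (CkS Cf) cha) (IH _ _ (CkS Ch) cfa))) => x Ux.
by rewrite -[RHS]/('D_('e_a) (f * h) x) deriveM; [|exact: dfa|exact: dha].
Qed.

Lemma Ck_derivable k U f a x : Ck k.+1 U f -> U x -> derivable f x 'e_a.
Proof. by case=> _ /(_ a)[+ _] => /[apply]. Qed.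

End smooth_functions_theory.

Section partial_derivatives.
Context {R : realType} {m : nat} (N : manifold R m).
Implicit Types (i : atlas N) (p : N) (a b k : 'I_m) (f h : N -> R).

Lemma image_chart i p : dom N i p -> (chart N i @` dom N i) (chart N i p).
Proof. by exists p. Qed.

(** The image of a chart is open, so agreement on [dom N i] becomes agreement near the point, which
    is what derivatives see. Outside the image [chartV] is arbitrary. *)
Lemma chart_near_eq i p f h : dom N i p ->
    (forall q, dom N i q -> f q = h q) ->
  {near chart N i p, f \o chartV N i =1 h \o chartV N i}.
Proof.
move=> ip fh; apply: open_near_eq (@chart_open _ _ N i) _ (image_chart ip).
by move=> _ [q iq <-] /=; rewrite chartK// fh.
Qed.

Lemma pd_ext i a p f h : dom N i p -> (forall q, dom N i q -> f q = h q) ->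
  pd i a f p = pd i a h p.
Proof. by move=> ip fh; apply: near_eq_derive; exact: chart_near_eq. Qed.

Lemma smooth_on_ext i f h : (forall q, dom N i q -> f q = h q) ->
  smooth_on i f -> smooth_on i h.
Proof.
move=> fh sf k; apply: (Ck_ext (@chart_open _ _ N i)) (sf k).
by move=> _ [q iq <-] /=; rewrite chartK// fh.
Qed.

Lemma smooth_on_cst i c : smooth_on i (fun=> c : R).
Proof. by move=> k; exact: Ck_cst. Qed.

Lemma smooth_onD i f h : smooth_on i f -> smooth_on i h ->
  smooth_on i (fun q => f q + h q).
Proof. by move=> sf sh k; exact: (CkD (@chart_open _ _ N i) (sf k) (sh k)). Qed.

Lemma smooth_onM i f h : smooth_on i f -> smooth_on i h ->
  smooth_on i (fun q => f q * h q).
Proof. by move=> sf sh k; exact: (CkM (@chart_open _ _ N i) (sf k) (sh k)). Qed.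

Lemma smooth_on_sum i (I : Type) (r : seq I) (P : pred I) (F : I -> N -> R) :
  (forall j, P j -> smooth_on i (F j)) ->
  smooth_on i (fun q => \sum_(j <- r | P j) F j q).
Proof.
move=> sF; elim: r => [|j r IH].
  by apply: smooth_on_ext (smooth_on_cst i 0) => q _; rewrite big_nil.
case Pj : (P j).
  by apply: smooth_on_ext (smooth_onD (sF _ Pj) IH) => q _; rewrite big_cons Pj.
by apply: smooth_on_ext IH => q _; rewrite big_cons Pj.
Qed.

Lemma smooth_on_pd i a f : smooth_on i f -> smooth_on i (pd i a f).
Proof.
move=> sf k; have [_ /(_ a)[_ +]] := sf k.+1.
by apply: (Ck_ext (@chart_open _ _ N i)) => _ [q iq <-] /=; rewrite /pd chartK.
Qed.

(** [pd] is a limit and has a meaningless value where that limit does not exist. Keeping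
    differentiability and value together lets the rules of calculus be chained. *)
Definition is_pd i a f p (d : R) :=
  is_derive (chart N i p) ('e_a : 'rV[R]_m) (f \o chartV N i) d.

Lemma is_pdE i a f p d : is_pd i a f p d -> pd i a f p = d.
Proof. by case. Qed.

Lemma is_pd_ext i a p f h d : dom N i p ->
  (forall q, dom N i q -> f q = h q) -> is_pd i a f p d -> is_pd i a h p d.
Proof. by move=> ip fh; apply: near_eq_is_derive; exact: chart_near_eq. Qed.

Lemma is_pd_cst i a c p : is_pd i a (fun=> c) p 0.
Proof. exact: is_derive_cst. Qed.

Lemma is_pd_pd i a f p : smooth_on i f -> dom N i p ->
  is_pd i a f p (pd i a f p).
Proof.
move=> sf ip; split=> //.
exact: (@Ck_derivable R m 0 _ _ a _ (sf 1%N) (image_chart ip)).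
Qed.

Lemma is_pdD i a f h p df dh : is_pd i a f p df -> is_pd i a h p dh ->
  is_pd i a (fun q => f q + h q) p (df + dh).
Proof. exact: is_deriveD. Qed.

Lemma is_pdN i a f p df : is_pd i a f p df ->
  is_pd i a (fun q => - f q) p (- df).
Proof. exact: is_deriveN. Qed.

Lemma is_pdM i a f h p df dh : dom N i p ->
    is_pd i a f p df -> is_pd i a h p dh ->
  is_pd i a (fun q => f q * h q) p (df * h p + f p * dh).
Proof.
move=> ip Df Dh.
have := @is_deriveM _ _ _ _ _ _ _ _ Df Dh.
by rewrite /= chartK// addrC /GRing.scale /= (mulrC _ df).
Qed.

Lemma is_pd_sum i a p (I : Type) (r : seq I) (P : pred I) (F : I -> N -> R)
    (d : I -> R) : (forall j, P j -> is_pd i a (F j) p (d j)) ->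
  is_pd i a (fun q => \sum_(j <- r | P j) F j q) p (\sum_(j <- r | P j) d j).
Proof.
move=> DF; elim: r => [|j r IH].
  rewrite big_nil (_ : (fun q => _) = fun=> 0); first exact: is_pd_cst.
  by apply/funext => q; rewrite big_nil.
rewrite big_cons (_ : (fun q => _) = fun q => if P j then
    F j q + \sum_(l <- r | P l) F l q else \sum_(l <- r | P l) F l q).
  by case Pj : (P j) => //; apply: is_pdD => //; exact: DF.
by apply/funext => q; rewrite big_cons.
Qed.

(** The existential rules serve the Christoffel symbols: the derivative of the inverse metric has to
    exist, but its value is never computed. *)
Lemma ex_is_pd_cst i a c p : exists d, is_pd i a (fun=> c) p d.
Proof. by exists 0; exact: is_pd_cst. Qed.

Lemma ex_is_pdM i a f h p : dom N i p ->
    (exists d, is_pd i a f p d) -> (exists d, is_pd i a h p d) ->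
  exists d, is_pd i a (fun q => f q * h q) p d.
Proof. by move=> ip [df Df] [dh Dh]; eexists; exact: is_pdM ip Df Dh. Qed.

Lemma ex_is_pdV i a f p : dom N i p -> f p != 0 ->
    (exists d, is_pd i a f p d) -> exists d, is_pd i a (fun q => (f q)^-1) p d.
Proof.
move=> ip fp [d [Df _]]; exists (pd i a (fun q => (f q)^-1) p); split=> //.
by apply: derivableV Df => /=; rewrite chartK.
Qed.

Lemma ex_is_pd_sum i a p (I : Type) (r : seq I) (F : I -> N -> R) :
  (forall j, exists d, is_pd i a (F j) p d) ->
  exists d, is_pd i a (fun q => \sum_(j <- r) F j q) p d.
Proof.
by move=> /choice[d Dd]; exists (\sum_(j <- r) d j); apply: is_pd_sum.
Qed.

Lemma ex_is_pd_prod i a p (I : Type) (r : seq I) (F : I -> N -> R) :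
  dom N i p ->
  (forall j, exists d, is_pd i a (F j) p d) ->
  exists d, is_pd i a (fun q => \prod_(j <- r) F j q) p d.
Proof.
move=> ip DF; elim: r => [|j r [d Dr]].
  exists 0; rewrite (_ : (fun q => _) = fun=> 1); first exact: is_pd_cst.
  by apply/funext => q; rewrite big_nil.
have [dj Dj] := DF j; eexists.
rewrite (_ : (fun q => _) = fun q => F j q * \prod_(l <- r) F l q).
  exact: is_pdM ip Dj Dr.
by apply/funext => q; rewrite big_cons.
Qed.

Lemma ex_is_pd_det i a p n (A : N -> 'M[R]_n) : dom N i p ->
  (forall b c : 'I_n, exists d, is_pd i a (fun q => A q b c) p d) ->
  exists d, is_pd i a (fun q => \det (A q)) p d.
Proof.
move=> ip DA; rewrite /determinant.
apply: ex_is_pd_sum => s.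
apply: (ex_is_pdM ip (ex_is_pd_cst i a _ p)).
by apply: (ex_is_pd_prod _ ip) => j; exact: DA.
Qed.

(** Cramer's rule: an entry of the inverse is a cofactor over the determinant, both polynomial in
    the entries. Invertibility on the whole chart domain keeps [invmx] in its cofactor branch near
    the point. *)
Lemma ex_is_pd_invmx i a p (A : N -> 'M[R]_m) : dom N i p ->
    (forall q, dom N i q -> A q \in unitmx) ->
    (forall b c, exists d, is_pd i a (fun q => A q b c) p d) ->
  forall b c, exists d, is_pd i a (fun q => invmx (A q) b c) p d.
Proof.
move=> ip uA DA b c.
have Ddet := ex_is_pd_det ip DA.
have Dmin : exists d, is_pd i a (fun q => \det (row' c (col' b (A q)))) p d.
  apply: ex_is_pd_det => // e f; have [d Dd] := DA (lift c e) (lift b f).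
  by exists d; under eq_fun do rewrite !mxE.
have det0 : \det (A p) != 0 by move: (uA _ ip); rewrite unitmxE unitfE.
have [d D] := ex_is_pdM ip (ex_is_pdV ip det0 Ddet)
  (ex_is_pdM ip (ex_is_pd_cst i a ((-1) ^+ (c + b)) p) Dmin).
exists (pd i a (fun q => invmx (A q) b c) p); split=> //.
case: D => D _; apply: near_eq_derivable D.
apply: chart_near_eq => // q iq.
by rewrite /invmx (uA q iq) !mxE.
Qed.

End partial_derivatives.

(** * Curvature in coordinates *)

Section coordinate_curvature.
Context {R : realType} {m : nat} (N : manifold R m) (g : mfield N).
Implicit Types (i : atlas N) (p : N) (a b k : 'I_m).

Lemma pd_cst i a (c : R) p : pd i a (fun=> c) p = 0.
Proof. exact: is_pdE (is_pd_cst i a c p). Qed.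

Lemma sum_delta_l (I : finType) (a : I) (F : I -> R) :
  \sum_b (b == a)%:R * F b = F a.
Proof.
rewrite (bigD1 a) //= eqxx mul1r big1 ?addr0// => b /negbTE ->.
by rewrite mul0r.
Qed.

Lemma vder_coord i a (f : N -> R) p :
  vder i (coord_field a) f p = pd i a f p.
Proof.
rewrite /vder /coord_field.
under eq_bigr do rewrite mxE eqxx /=.
exact: (sum_delta_l a (fun b => pd i b f p)).
Qed.

Lemma pd_coord i a b k p : pd i a (fun q => coord_field b q 0 k) p = 0.
Proof. exact: pd_cst. Qed.

Lemma lie_coord i a b p : lie i (coord_field a) (coord_field b) p = 0.
Proof. by apply/rowP => k; rewrite mxE !vder_coord !pd_coord subrr mxE. Qed.

Lemma nabla_coord i a (Y : lfield N) p k :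
  nabla g i (coord_field a) Y p 0 k =
  pd i a (fun q => Y q 0 k) p + \sum_b Y p 0 b * christoffel g i a b k p.
Proof.
rewrite mxE vder_coord; congr (_ + _).
under eq_bigr => c _.
  under eq_bigr do rewrite -mulrA.
  rewrite -mulr_sumr mxE eqxx /=.
  over.
exact: (sum_delta_l a (fun c => \sum_b Y p 0 b * christoffel g i c b k p)).
Qed.

Lemma nabla_coord_coord i a b p k :
  nabla g i (coord_field a) (coord_field b) p 0 k = christoffel g i a b k p.
Proof.
rewrite nabla_coord pd_coord add0r.
under eq_bigr do rewrite mxE eqxx /=.
exact: (sum_delta_l b (fun c => christoffel g i a c k p)).
Qed.

Lemma nabla_lie_coord i a b (Z : lfield N) p :
  nabla g i (lie i (coord_field a) (coord_field b)) Z p = 0.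
Proof.
apply/rowP => k; rewrite !mxE /vder big1 ?add0r => [|c _]; last first.
  by rewrite lie_coord mxE mul0r.
by rewrite big1 // => c _; rewrite big1 // => d _; rewrite lie_coord mxE !mul0r.
Qed.

Lemma ricciE i p a b : ricci g i p a b =
  \sum_k (pd i k (christoffel g i a b k) p - pd i a (christoffel g i k b k) p
    + \sum_e christoffel g i a b e p * christoffel g i k e k p
    - \sum_e christoffel g i k b e p * christoffel g i a e k p).
Proof.
rewrite mxE; apply: eq_bigr => k _.
rewrite /curv nabla_lie_coord subr0 mxE nabla_coord.
rewrite [X in _ + X]mxE nabla_coord opprD addrACA -!addrA.
have E c d e : (fun q => nabla g i (coord_field c) (coord_field d) q 0 e) =
    christoffel g i c d e by apply/funext => q; exact: nabla_coord_coord.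
rewrite !E; congr (_ + (_ + (_ - _))).
  by apply: eq_bigr => e _; rewrite nabla_coord_coord.
by apply: eq_bigr => e _; rewrite nabla_coord_coord.
Qed.

(* Christoffel symbols of the first kind, [ab, k]. *)
Definition christoffel1 i a b k p : R :=
  2^-1 * (pd i a (fun q => g i q b k) p + pd i b (fun q => g i q a k) p
          - pd i k (fun q => g i q a b) p).

Hypothesis metric_g : is_metric g.

Lemma metric_sym i p a b : dom N i p -> g i p a b = g i p b a.
Proof. by case: metric_g => _ P /P[+ _] => {1}<-; rewrite mxE. Qed.

Lemma metric_unit i p : dom N i p -> g i p \in unitmx.
Proof.
case: metric_g => _ P /P[_ pos].
rewrite unitmxE unitfE; apply/negP => /det0P[v v0 vg].
by have := pos v v0; rewrite vg mul0mx mxE ltxx.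
Qed.

Lemma metric_smooth i a b : smooth_on i (fun q => g i q a b).
Proof. by case: metric_g => -[]. Qed.

(** Lowering the upper index is injective, so proposed values can be checked against symbols of the
    first kind. The inverse metric must be seen to be symmetric, because [christoffel] contracts its
    second index and [v] its first. *)
Lemma christoffel_unique i p a b (v : 'rV[R]_m) : dom N i p ->
    (forall k, (v *m g i p) 0 k = christoffel1 i a b k p) ->
  forall k, christoffel g i a b k p = v 0 k.
Proof.
move=> ip vg k; have u := metric_unit ip.
rewrite -(mulmxK u v) mxE /christoffel mulr_sumr; apply: eq_bigr => l _.
rewrite vg mulrCA mulrC; congr (_ * _).
have /matrixP/(_ l k) : (invmx (g i p))^T = invmx (g i p).
  rewrite trmx_inv; congr invmx; apply/matrixP => x y.
  by rewrite mxE metric_sym.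
by rewrite mxE.
Qed.

Lemma christoffelK i p a b k : dom N i p ->
  \sum_l christoffel g i a b l p * g i p l k = christoffel1 i a b k p.
Proof.
move=> ip; pose v := (\row_l christoffel1 i a b l p) *m invmx (g i p).
have E : forall l, christoffel g i a b l p = v 0 l.
  by apply: christoffel_unique => // l; rewrite mulmxKV ?metric_unit// mxE.
have <- : (v *m g i p) 0 k = christoffel1 i a b k p.
  by rewrite mulmxKV ?metric_unit// mxE.
by rewrite mxE; apply: eq_bigr => l _; rewrite E.
Qed.

Lemma christoffelC i p a b k : dom N i p ->
  christoffel g i a b k p = christoffel g i b a k p.
Proof.
move=> ip; congr (_ * _); apply: eq_bigr => l _; congr (_ * (_ - _)).
  by rewrite addrC.
by apply: pd_ext => // q iq; rewrite metric_sym.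
Qed.

Lemma is_pd_christoffel i p a b k c : dom N i p ->
  is_pd i c (christoffel g i a b k) p (pd i c (christoffel g i a b k) p).
Proof.
move=> ip; suff [d D] : exists d, is_pd i c (christoffel g i a b k) p d.
  by rewrite (is_pdE D).
apply: (ex_is_pdM ip (ex_is_pd_cst _ _ _ _)).
apply: ex_is_pd_sum => l; apply: (ex_is_pdM ip).
  apply: (@ex_is_pd_invmx R m N i c p (g i) ip) => [q|x y].
    exact: metric_unit.
  by eexists; apply: is_pd_pd => //; exact: metric_smooth.
eexists; apply: is_pdD; last apply: is_pdN; first apply: is_pdD;
  by apply: is_pd_pd => //; apply: smooth_on_pd; exact: metric_smooth.
Qed.

(** Moving the derivative in direction [a] outside the sum exposes the trace of the symbols, which
    is simple for the lift. This exchange is where differentiability of the Christoffel symbols is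
    used. *)
Lemma ricci_traceE i p a b : dom N i p -> ricci g i p a b =
  \sum_k pd i k (christoffel g i a b k) p
  - pd i a (fun q => \sum_k christoffel g i k b k q) p
  + \sum_e christoffel g i a b e p * (\sum_k christoffel g i k e k p)
  - \sum_k \sum_e christoffel g i k b e p * christoffel g i a e k p.
Proof.
move=> ip; rewrite ricciE !big_split /= !sumrN; congr (_ - _ + _ - _).
  apply/esym/is_pdE; apply: is_pd_sum => k _; exact: is_pd_christoffel.
by rewrite exchange_big /=; apply: eq_bigr => e _; rewrite mulr_sumr.
Qed.

(** Every term of [ricci_traceE] is visibly symmetric except the derivative of the trace, a Hessian
    of log sqrt(det g). Its symmetry is taken as a hypothesis, easily checked where the lemma is
    applied. *)
Lemma ricci_sym i p a b : dom N i p ->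
    pd i a (fun q => \sum_k christoffel g i k b k q) p =
    pd i b (fun q => \sum_k christoffel g i k a k q) p ->
  ricci g i p a b = ricci g i p b a.
Proof.
move=> ip E; rewrite (ricci_traceE a b ip) (ricci_traceE b a ip).
have S := fun x y k => christoffelC x y k ip.
apply: congr2 (congr2 +%R (congr2 +%R _ (congr1 -%R E)) _) (congr1 -%R _).
- apply: eq_bigr => k _; apply: (pd_ext _ ip) => q iq.
  exact (christoffelC a b k iq).
- apply: eq_bigr => e _; exact (congr2 *%R (S a b e) erefl).
rewrite exchange_big; apply: eq_bigr => k _; apply: eq_bigr => e _.
rewrite mulrC; exact (congr2 *%R (S a k e) (S e b k)).
Qed.

End coordinate_curvature.

(** * Partial derivatives and Jacobians on the product with a line *)

Section line_calculus.
Context {R : realType} {m : nat} (N : manifold R m).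
Let M := line_manifold N.
Implicit Types (i : atlas N) (p : M) (a b k : 'I_m).

Lemma pd_line_l i (a : 'I_1) (f : N -> R) p :
  @pd R _ M i (lshift m a) (fun q : M => f q.2) p = 0.
Proof.
have /= E := @derive_rsubmx R m (f \o chartV N i) (chart M i p)
  (delta_mx 0 (lshift m a)).
by rewrite /pd -[LHS]/('D_(delta_mx 0 (lshift m a)) ((f \o chartV N i) \o rsubmx)
  (chart M i p)) E rsubmx_delta_l (derive_dir0 _ _).2.
Qed.

Lemma pd_line_r i a (f : N -> R) p :
  @pd R _ M i (rshift 1 a) (fun q : M => f q.2) p = pd i a f p.2.
Proof.
have /= E := @derive_rsubmx R m (f \o chartV N i) (chart M i p)
  (delta_mx 0 (rshift 1 a)).
rewrite /pd -[LHS]/('D_(delta_mx 0 (rshift 1 a)) ((f \o chartV N i) \o rsubmx)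
  (chart M i p)) E rsubmx_delta_r.
by rewrite /= /line_chart row_mxKr.
Qed.

Lemma smooth_on_line i (f : N -> R) : smooth_on i f ->
  @smooth_on R _ M i (fun q : M => f q.2).
Proof.
move=> sf k; have := Ck_rsubmx (sf k).
by rewrite /smooth_on /= (line_image i (dom N i)).
Qed.

Lemma pd_line_fst i (a : 'I_(1 + m)) p :
  @pd R _ M i a fst p = (a == lshift m 0)%:R.
Proof.
rewrite /pd.
rewrite (_ : _ \o _ = fun x : 'rV[R]_(1 + m) => x 0 (lshift m 0)); last first.
  by apply/funext => x /=; rewrite mxE.
apply: (cvg_lim (@Rhausdorff R)).
apply: (@cvg_trans _ (((fun=> (a == lshift m 0)%:R) : R -> R) @ 0^'));
  last exact: cvg_cst.
apply: near_eq_cvg; near=> h => /=.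
have h0 : h != 0 by near: h; exact: nbhs_dnbhs_neq.
by rewrite !mxE eqxx /= addrK eq_sym /GRing.scale /= mulKf.
Unshelve. all: by end_near. Qed.

Lemma jac_line (i j : atlas N) p :
  @jac R _ M i j p = block_mx 1%:M 0 0 (jac i j p.2).
Proof.
apply/matrixP => a b; rewrite mxE.
case: (split_ordP b) => {b} b ->.
  rewrite (_ : (fun q => _) = fst); last first.
    by apply/funext => q /=; rewrite /line_chart row_mxEl ord1 mxE eqxx.
  rewrite pd_line_fst; case: (split_ordP a) => {}a ->.
    by rewrite block_mxEul !ord1 mxE !eqxx.
  by rewrite block_mxEdl mxE eq_rlshift.
rewrite (_ : (fun q => _) = fun q : M => chart N j q.2 0 b); last first.
  by apply/funext => q /=; rewrite /line_chart row_mxEr.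
case: (split_ordP a) => {}a ->.
  by rewrite block_mxEur mxE (pd_line_l i a (fun q => chart N j q 0 b)).
by rewrite block_mxEdr mxE (pd_line_r i a (fun q => chart N j q 0 b)).
Qed.

End line_calculus.

(** * Pointwise algebra *)

Section hermitian_algebra.
Context {F : realFieldType} {m : nat}.
Variables (J g : 'M[F]_m).
Hypotheses (g_sym : g^T = g) (g_unit : g \in unitmx).
Hypotheses (JJ : J *m J = - 1%:M) (JgJ : J *m g *m J^T = g).

Lemma almost_complex_entry b c : \sum_k J b k * J k c = - (b == c)%:R.
Proof. by have /matrixP/(_ b c) := JJ; rewrite !mxE. Qed.

(** Multiply [JgJ] by [J] on the left. Since [g *m J^T] is the matrix of omega, omega can be handled
    as - J g. *)
Lemma hermitian_gJT : g *m J^T = - (J *m g).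
Proof.
by rewrite -{2}JgJ -mulmxA mulmxA JJ mulNmx mul1mx opprK.
Qed.

Lemma hermitian_antisym : (J *m g)^T = - (J *m g).
Proof. by rewrite trmx_mul g_sym hermitian_gJT. Qed.

Lemma hermitian_J_unit : J \in unitmx.
Proof.
have : J *m (- J) = 1%:M by rewrite mulmxN JJ opprK.
by case/mulmx1_unit.
Qed.

Lemma eq_opp_eq0 (x : F) : x = - x -> x = 0.
Proof. lra. Qed.

(** J = (J g) g^-1 = - g J^T g^-1, so J has the trace of - J^T. *)
Lemma hermitian_tr0 : \tr J = 0.
Proof.
apply: eq_opp_eq0; rewrite -{1}(mulmxK g_unit J) -[in LHS](opprK (J *m g)).
rewrite -hermitian_gJT mulNmx raddfN /= mxtrace_mulC mulmxA mulVmx// mul1mx.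
by rewrite mxtrace_tr.
Qed.

(* [T a] stands for the matrix of nabla_a J. *)
Variable T : 'I_m -> 'M[F]_m.
Hypothesis TJ : forall a, T a *m J = - (J *m T a).
Hypothesis T_antisym : forall a, (T a *m g)^T = - (T a *m g).
Hypothesis T_cyclic : forall a b c,
  (T a *m g) b c + (T b *m g) c a + (T c *m g) a b = 0.

(* Contract the cyclic identity with the bivector [g^-1 J]: the first term is
   - tr (T a J) = 0 because [T a] anticommutes with [J], and the other two
   coincide. *)
Lemma hermitian_contraction : \sum_b row b (invmx g *m T b) = 0.
Proof.
set h := invmx g; set s := \sum_b _.
have hT : h^T = h by rewrite trmx_inv g_sym.
have hJT : (h *m J)^T = - (h *m J).
  rewrite trmx_mul hT; apply: (can_inj (mulKmx g_unit)).
  rewrite mulmxA hermitian_gJT mulNmx mulmxK// mulmxN mulmxA mulmxV//.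
  by rewrite mul1mx.
have t1 a : \sum_b \sum_c (T a *m g) b c * (h *m J) b c = 0.
  have -> : \sum_b \sum_c (T a *m g) b c * (h *m J) b c =
      \tr (T a *m g *m (h *m J)^T).
    apply: eq_bigr => b _; rewrite [RHS]mxE; apply: eq_bigr => c _.
    by rewrite [X in _ = _ * X]mxE.
  rewrite hJT mulmxN raddfN /= mulmxA mulmxK//; apply/eqP; rewrite oppr_eq0.
  by apply/eqP/eq_opp_eq0; rewrite {1}TJ raddfN /= mxtrace_mulC.
have t2 a : \sum_b \sum_c (T b *m g) c a * (h *m J) b c = - (s *m (J *m g)) 0 a.
  rewrite /s mulmx_suml summxE -sumrN; apply: eq_bigr => b _.
  transitivity ((h *m J *m (T b *m g)) b a).
    by rewrite mxE; apply: eq_bigr => c _; rewrite mulrC.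
  have -> : h *m J *m (T b *m g) = - (h *m T b *m (J *m g)).
    by rewrite !mulmxA -(mulmxA h (T b)) TJ mulmxN mulNmx opprK !mulmxA.
  by rewrite -row_mul [X in _ = - X]mxE [LHS]mxE.
have t3 a : \sum_b \sum_c (T c *m g) a b * (h *m J) b c = - (s *m (J *m g)) 0 a.
  rewrite -t2 exchange_big /=; apply: eq_bigr => b _; apply: eq_bigr => c _.
  have /matrixP/(_ c a) := T_antisym b; have /matrixP/(_ b c) := hJT.
  by rewrite !mxE => -> ->; rewrite mulrNN.
have sJg : s *m (J *m g) = 0.
  apply/rowP => a; rewrite [RHS]mxE; apply: eq_opp_eq0.
  have : \sum_b \sum_c ((T a *m g) b c + (T b *m g) c a + (T c *m g) a b)
      * (h *m J) b c = 0.
    by rewrite big1 // => b _; rewrite big1// => c _; rewrite T_cyclic mul0r.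
  under eq_bigr => b _ do
    [under eq_bigr do rewrite !mulrDl; rewrite !big_split /=].
  rewrite !big_split /= t1 t2 t3; lra.
have u : J *m g \in unitmx by rewrite unitmx_mul hermitian_J_unit.
by rewrite -(mulmxK u s) sJg mul0mx.
Qed.

(** Insert g g^-1 after [T k]. Antisymmetry of [T k *m g] then turns the divergence into minus an
    entry of the contracted row of [hermitian_contraction] times [g]. *)
Lemma hermitian_div0 b : \sum_k T k b k = 0.
Proof.
transitivity (\sum_k \sum_c (T k *m g) b c * invmx g c k).
  by apply: eq_bigr => k _; rewrite -{1}(mulmxK g_unit (T k)) mxE.
transitivity (- ((\sum_k row k (invmx g *m T k)) *m g) 0 b); last first.
  by rewrite hermitian_contraction mul0mx mxE oppr0.
rewrite mulmx_suml summxE -sumrN; apply: eq_bigr => k _.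
rewrite -row_mul mxE -mulmxA mxE -sumrN; apply: eq_bigr => c _.
have /matrixP/(_ c b) := T_antisym k.
have /matrixP/(_ c k) : (invmx g)^T = invmx g by rewrite trmx_inv g_sym.
by rewrite !mxE => <- ->; rewrite mulNr mulrC.
Qed.

End hermitian_algebra.

(** * Cancellations in the Ricci tensor of the lift, as identities between finite sums *)

Section lift_ricci_algebra.
Context {F : realFieldType} {m : nat}.
Variables (J g : 'M[F]_m) (t : 'I_m -> F) (Gam : 'I_m -> 'I_m -> 'I_m -> F).
(* [t], [Gam], [dJ], [dt] stand for tau, the Christoffel symbols of [g] and the
   partial derivatives of J and tau (derivative index first); [S] for the
   symmetrised derivative of tau, [K] and [K0] for the Christoffel symbols
   G^k_ab and G^0_ab of the lift. *)
Variables (dJ : 'I_m -> 'M[F]_m) (dt S : 'I_m -> 'I_m -> F).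
Hypotheses (JJ : J *m J = - 1%:M) (JgJ : J *m g *m J^T = g).
Hypotheses (Jtr : \tr J = 0) (g_sym : g^T = g).
Hypothesis Gam_sym : forall a b k, Gam a b k = Gam b a k.
Hypothesis S_sym : forall a b, S a b = S b a.
Hypothesis J_div0 : forall b,
  \sum_k (dJ k b k - \sum_e Gam k b e * J e k + \sum_e J b e * Gam k e k) = 0.
Hypothesis dt_S : forall k b, dt k b - S k b = (g *m J^T) k b.

(** [u b] is tau(J d_b), the symbol G^0_0b, and [gam] is the traced symbol of the base. [C] and [D]
    are the contractions of Gamma with J that must cancel in the end. *)
Let u b := \sum_k t k * J b k.
Let gam b := \sum_k Gam k b k.
Let C b := \sum_k \sum_e Gam k b e * J e k.
Let D a b := \sum_k \sum_e Gam k b e * t e * J a k.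
Let K a b k := Gam a b k - (t b * J a k + t a * J b k).
Let K0 a b := S a b - \sum_k t k * K a b k.

(** The left side is G^0_0b + G^k_kb. One correction in [K] traces to t_b tr J = 0, the other to
    [u b], which the index 0 compensates. *)
Lemma lift_trace b : u b + \sum_k K k b k = gam b.
Proof.
rewrite /K sumrB big_split /= -mulr_sumr -/(\tr J) Jtr mulr0 add0r.
by rewrite addrC subrK.
Qed.

Lemma sum_J_u a : \sum_k u k * J a k = - t a.
Proof.
rewrite /u; under eq_bigr do rewrite mulr_suml.
rewrite exchange_big /=.
have E l : \sum_k t l * J k l * J a k = - (t l * (a == l)%:R).
  under eq_bigr do rewrite -mulrA (mulrC (J _ l)).
  by rewrite -mulr_sumr almost_complex_entry// mulrN.
under eq_bigr do rewrite E.
rewrite sumrN (bigD1 a) //= eqxx mulr1 big1 ?addr0// => l /negbTE.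
by rewrite eq_sym => ->; rewrite mulr0.
Qed.

(** Vanishing of the covariant divergence trades the derivatives of J for Christoffel symbols, after
    which the remaining cancellations are algebraic. *)
Lemma J_divE b : \sum_k dJ k b k = C b - \sum_e J b e * gam e.
Proof.
have := J_div0 b; rewrite !big_split /= sumrN => /eqP.
rewrite -addrA addr_eq0 => /eqP ->; rewrite opprD opprK -/(C b); congr (_ - _).
by rewrite exchange_big /=; apply: eq_bigr => e _; rewrite mulr_sumr.
Qed.

(** Source of the term - 2 g: the antisymmetric half of [dt] is g J^T, and J g J^T = g. *)
Lemma sum_J_dt a b : \sum_k dt k b * J a k = g a b + \sum_k S k b * J a k.
Proof.
rewrite -[in RHS]JgJ -mulmxA mxE -big_split /=; apply: eq_bigr => k _.
by rewrite -dt_S; ring.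
Qed.

Lemma sum_JJ : \sum_k \sum_e J k e * J e k = - m%:R.
Proof.
under eq_bigr do rewrite almost_complex_entry// eqxx.
by rewrite sumrN sumr_const card_ord.
Qed.

Lemma sum_sum_add (f h : 'I_m -> 'I_m -> F) :
  \sum_k \sum_e (f k e + h k e) = \sum_k \sum_e f k e + \sum_k \sum_e h k e.
Proof. by under eq_bigr do rewrite big_split /=; rewrite big_split. Qed.

Lemma sum_sum_scale x (f : 'I_m -> 'I_m -> F) :
  \sum_k \sum_e x * f k e = x * \sum_k \sum_e f k e.
Proof. by rewrite mulr_sumr; apply: eq_bigr => k _; rewrite mulr_sumr. Qed.

(** The left side is [ricci_traceE] at the indices (0, b) with the symbols of the lift inserted. The
    terms in [C], [gam] and [u] cancel, leaving - t_b tr(J^2). *)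
Lemma lift_ricci_mixed b : \sum_k (- dJ k b k) + \sum_e (- J b e) * gam e
  - (\sum_e (- J b e * u e) + \sum_k \sum_e K k b e * (- J e k)) = m%:R * t b.
Proof.
rewrite sumrN J_divE.
have -> : \sum_k \sum_e K k b e * - J e k =
    - C b - m%:R * t b + \sum_e J b e * u e.
  have -> : - C b = \sum_k \sum_e -1 * (Gam k b e * J e k).
    by rewrite sum_sum_scale mulN1r.
  have -> : \sum_e J b e * u e = \sum_k \sum_e t k * J b e * J e k.
    rewrite exchange_big /=; apply: eq_bigr => e _; rewrite mulr_sumr.
    by apply: eq_bigr => k _; ring.
  rewrite -mulNr -sum_JJ (mulrC _ (t b)) -sum_sum_scale -!sum_sum_add.
  by apply: eq_bigr => k _; apply: eq_bigr => e _; rewrite /K; ring.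
have EN (h : 'I_m -> F) : \sum_e - J b e * h e = - \sum_e J b e * h e.
  by rewrite -sumrN; apply: eq_bigr => e _; rewrite mulNr.
rewrite !EN; ring.
Qed.

Lemma lift_ricci_vertical : - \sum_k \sum_e (- J k e) * (- J e k) = m%:R.
Proof.
rewrite -[RHS]opprK -sum_JJ; congr (- _).
by apply: eq_bigr => k _; apply: eq_bigr => e _; rewrite mulrNN.
Qed.

Lemma sum_K0_J a b :
  \sum_k K0 k b * J a k = \sum_k S k b * J a k - D a b - t a * t b + u a * u b.
Proof.
have -> : D a b = \sum_k \sum_e Gam k b e * t e * J a k by [].
have E k : K0 k b * J a k = S k b * J a k
    - \sum_e Gam k b e * t e * J a k + t b * (u k * J a k) + u b * (t k * J a k).
  rewrite /K0 mulrBl -!addrA; congr (_ + _).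
  have -> : u k = \sum_e t e * J k e by [].
  have -> : u b = \sum_e t e * J b e by [].
  rewrite !mulr_suml !mulr_sumr -!sumrN -!big_split /=.
  by apply: eq_bigr => e _; rewrite /K; ring.
under eq_bigr do rewrite E.
rewrite !big_split /= sumrN -!mulr_sumr sum_J_u -/(u a); ring.
Qed.

Lemma sum_KK a b : \sum_k \sum_e K k b e * K a e k =
  \sum_k \sum_e Gam k b e * Gam a e k - D a b - D b a - t a * C b - t b * C a
  - 2 * (t a * t b) - m%:R * (t a * t b) + u a * u b.
Proof.
(* [P] and [Q] are the cross terms of the product in which two factors J chain up to J^2 acting on
   [t]; each sums to - t_a t_b. The two other terms quadratic in J give t_a t_b tr(J^2) and u_a
   u_b. *)
pose P k e := t b * J k e * (t e * J a k).
pose Q k e := t k * J b e * (t a * J e k).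
have EP : \sum_k \sum_e P k e = - (t a * t b).
  transitivity (t b * \sum_k u k * J a k); last by rewrite sum_J_u; ring.
  rewrite mulr_sumr; apply: eq_bigr => k _; rewrite mulr_suml mulr_sumr.
  by apply: eq_bigr => e _; rewrite /P; ring.
have EQ : \sum_k \sum_e Q k e = - (t a * t b).
  transitivity (t a * \sum_e u e * J b e); last by rewrite sum_J_u; ring.
  rewrite mulr_sumr exchange_big; apply: eq_bigr => e _.
  rewrite mulr_suml mulr_sumr.
  by apply: eq_bigr => k _; rewrite /Q; ring.
have Euu : u a * u b = \sum_k \sum_e t k * J a k * (t e * J b e).
  by rewrite mulr_suml; apply: eq_bigr => k _; rewrite mulr_sumr.
have EDb : D b a = \sum_k \sum_e Gam a e k * t k * J b e.
  rewrite /D exchange_big; apply: eq_bigr => k _; apply: eq_bigr => e _.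
  by rewrite Gam_sym.
have ECa : C a = \sum_k \sum_e Gam a e k * J k e.
  rewrite /C exchange_big; apply: eq_bigr => k _; apply: eq_bigr => e _.
  by rewrite Gam_sym.
have -> : \sum_k \sum_e K k b e * K a e k =
    \sum_k \sum_e (Gam k b e * Gam a e k + -1 * (Gam k b e * t e * J a k)
    + -1 * (Gam a e k * t k * J b e) + (- t a) * (Gam k b e * J e k)
    + (- t b) * (Gam a e k * J k e) + P k e + Q k e
    + t a * t b * (J k e * J e k) + t k * J a k * (t e * J b e)).
  by apply: eq_bigr => k _; apply: eq_bigr => e _; rewrite /K /P /Q; ring.
rewrite !sum_sum_add !sum_sum_scale EP EQ -Euu -EDb -ECa -/(D a b) -/(C b) sum_JJ.
ring.
Qed.

(** [dGam] and [dgam] pass unchanged into Ric(g), so they may be arbitrary. Among the other terms,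
    [C], [D], [S] and [u] cancel; the two - t_a t_b from [sum_K0_J] cancel the 2 t_a t_b of
    [sum_KK]; what stays is - 2 g from [sum_J_dt] and the multiple of t_a t_b from tr(J^2). *)
Lemma lift_ricci_horizontal a b
    (dGam : 'I_m -> F) (dgam : F) :
  \sum_k (dGam k - (dt k b * J a k + t b * dJ k a k
                    + (dt k a * J b k + t a * dJ k b k)))
  - dgam + \sum_e K a b e * gam e
  - (u b * u a + \sum_e (- J b e) * K0 a e
     + \sum_k (K0 k b * (- J a k) + \sum_e K k b e * K a e k))
  = \sum_k dGam k - dgam + \sum_e Gam a b e * gam e
    - \sum_k \sum_e Gam k b e * Gam a e k
    - 2 * g a b + m%:R * (t a * t b).
Proof.
have -> : \sum_k (dGam k - (dt k b * J a k + t b * dJ k a k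
                    + (dt k a * J b k + t a * dJ k b k))) =
    \sum_k dGam k - (g a b + \sum_k S k b * J a k
      + t b * (C a - \sum_e J a e * gam e) + (g a b + \sum_k S k a * J b k
      + t a * (C b - \sum_e J b e * gam e))).
  have gab : g a b = g b a by rewrite -[in LHS]g_sym mxE.
  rewrite {2}gab -!sum_J_dt -!J_divE !mulr_sumr -!big_split /= -sumrN.
  by rewrite -big_split.
have -> : \sum_e K a b e * gam e = \sum_e Gam a b e * gam e
    - t b * (\sum_e J a e * gam e) - t a * (\sum_e J b e * gam e).
  rewrite !mulr_sumr -!sumrN -!big_split /=; apply: eq_bigr => e _.
  by rewrite /K; ring.
have -> : \sum_e - J b e * K0 a e = - \sum_k K0 k a * J b k.
  rewrite -sumrN; apply: eq_bigr => e _.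
  have -> : K0 a e = K0 e a; last by ring.
  rewrite /K0 S_sym; congr (_ - _); apply: eq_bigr => k _.
  by rewrite /K Gam_sym (addrC (t e * _)).
rewrite [in X in _ - X]big_split /= sum_KK.
have -> : \sum_k K0 k b * - J a k = - \sum_k K0 k b * J a k.
  by rewrite -sumrN; apply: eq_bigr => k _; rewrite mulrN.
rewrite !sum_K0_J; ring.
Qed.

End lift_ricci_algebra.

(** * Divergence of the complex structure *)

Section almost_hermitian.
Context {R : realType} {m : nat} (N : manifold R m) (J g : mfield N).
Hypothesis kahler : is_kahler J g.
Implicit Types (i : atlas N) (p : N) (a b c k : 'I_m).

Let metric_g : is_metric g. Proof. by case: kahler. Qed.

Lemma kahler_JJ i p : dom N i p -> J i p *m J i p = - 1%:M.
Proof. by case: kahler => _ _ P _ _ /P[]. Qed.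

Lemma kahler_JgJ i p : dom N i p -> J i p *m g i p *m (J i p)^T = g i p.
Proof. by case: kahler => _ _ P _ _ /P[]. Qed.

Lemma metric_trmx i p : dom N i p -> (g i p)^T = g i p.
Proof. by case: metric_g => _ P /P[]. Qed.

Lemma is_pd_J i p a b c : dom N i p ->
  is_pd i a (fun q => J i q b c) p (pd i a (fun q => J i q b c) p).
Proof. by case: kahler => _ [sJ _] _ _ _ ip; exact: is_pd_pd. Qed.

Lemma is_pd_metric i p a b c : dom N i p ->
  is_pd i a (fun q => g i q b c) p (pd i a (fun q => g i q b c) p).
Proof. by move=> ip; apply: is_pd_pd => //; exact: metric_smooth. Qed.

Lemma app2_coord i (G : mfield N) a b p :
  app2 i G (coord_field a) (coord_field b) p = G i p a b.
Proof.
by rewrite /app2 /coord_field -rowE trmx_delta -colE !mxE.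
Qed.

Definition pd_mx (A : N -> 'M[R]_m) i a p : 'M[R]_m :=
  \matrix_(b, c) pd i a (fun q => A q b c) p.

Definition chr_mx i p a : 'M[R]_m := \matrix_(b, e) christoffel g i a b e p.

(** Row b holds the components of nabla_a (J d_b) - J (nabla_a d_b). Vectors are rows, hence the
    order of the products. *)
Definition nablaJ i p a : 'M[R]_m :=
  pd_mx (J i) i a p - chr_mx i p a *m J i p + J i p *m chr_mx i p a.

(** This is nabla g = 0: the two products are the first-kind symbols [ab, c] and [ac, b], whose sum
    is d_a g_bc. *)
Lemma pd_metric i p a : dom N i p ->
  pd_mx (g i) i a p = chr_mx i p a *m g i p + g i p *m (chr_mx i p a)^T.
Proof.
move=> ip; apply/matrixP => b c; rewrite !mxE.
have -> : \sum_j chr_mx i p a b j * g i p j c = christoffel1 g i a b c p.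
  by rewrite -christoffelK//; apply: eq_bigr => l _; rewrite mxE.
have -> : \sum_j g i p b j * (chr_mx i p a)^T j c = christoffel1 g i a c b p.
  rewrite -christoffelK//; apply: eq_bigr => l _.
  by rewrite !mxE mulrC (metric_sym metric_g).
have E : pd i a (fun q => g i q c b) p = pd i a (fun q => g i q b c) p.
  by apply: pd_ext => // q iq; rewrite (metric_sym metric_g).
by rewrite /christoffel1 E; field.
Qed.

(** Differentiate J^2 = -1; the connection terms cancel because J^2 is scalar. *)
Lemma nablaJ_J i p a : dom N i p ->
  nablaJ i p a *m J i p = - (J i p *m nablaJ i p a).
Proof.
move=> ip; have JJ := kahler_JJ ip.
have dJJ : pd_mx (J i) i a p *m J i p + J i p *m pd_mx (J i) i a p = 0.
  apply/matrixP => b c; rewrite !mxE -big_split /=.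
  have D := is_pd_sum (index_enum 'I_m) (P := xpredT)
    (fun k _ => is_pdM ip (is_pd_J a b k ip) (is_pd_J a k c ip)).
  transitivity (pd i a (fun q => \sum_k J i q b k * J i q k c) p).
    by rewrite (is_pdE D); apply: eq_bigr => k _; rewrite !mxE.
  rewrite -[RHS](pd_cst i a ((- 1%:M : 'M[R]_m) b c) p); apply: pd_ext => // q iq.
  by rewrite -(kahler_JJ iq) mxE.
apply/eqP; rewrite -addr_eq0 /nablaJ !mulmxDl !mulmxDr mulNmx mulmxN.
rewrite -(mulmxA (chr_mx _ _ _)) JJ mulmxN mulmx1 opprK.
rewrite [J i p *m (J i p *m _)]mulmxA JJ mulNmx mul1mx !mulmxA.
have Z (x y z w : 'M[R]_m) : x + y + z + (w - z - y) = x + w.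
  by rewrite -!addrA (addrCA z) addNKr (addrC w) addNKr.
by rewrite Z dJJ.
Qed.

Lemma is_pd_kahler_form i p a b c : dom N i p ->
  is_pd i a (fun q => kahler_form J g i q b c) p
  (- ((pd_mx (J i) i a p *m g i p) b c + (J i p *m pd_mx (g i) i a p) b c)).
Proof.
move=> ip; rewrite !mxE -big_split /=.
have D := is_pdN (is_pd_sum (index_enum 'I_m) (P := xpredT) (fun k _ =>
  is_pdM ip (is_pd_J a b k ip) (is_pd_metric a k c ip))).
apply: is_pd_ext (_ : is_pd i a (fun q => - \sum_k J i q b k * g i q k c) p _).
- exact: ip.
- move=> q iq.
  by rewrite /kahler_form (hermitian_gJT (kahler_JJ iq) (kahler_JgJ iq)) !mxE.
rewrite (_ : \sum_j _ = \sum_k (pd i a (fun q => J i q b k) p * g i p k c +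
  J i p b k * pd i a (fun q => g i q k c) p)) //.
by apply: eq_bigr => k _; rewrite !mxE.
Qed.

Lemma pd_kahler_form i p a b c : dom N i p ->
  pd i a (fun q => kahler_form J g i q b c) p =
  - ((pd_mx (J i) i a p *m g i p) b c + (J i p *m pd_mx (g i) i a p) b c).
Proof. by move=> ip; exact: is_pdE (is_pd_kahler_form a b c ip). Qed.

(** As nabla g = 0, the right side is the covariant derivative of J g, that is of - omega.
    Symmetries of omega can thus be carried over to nabla J. *)
Lemma nablaJ_g i p a : dom N i p ->
  nablaJ i p a *m g i p = pd_mx (J i) i a p *m g i p + J i p *m pd_mx (g i) i a p
    - chr_mx i p a *m (J i p *m g i p) - (J i p *m g i p) *m (chr_mx i p a)^T.
Proof.
move=> ip; rewrite pd_metric// /nablaJ !mulmxDl mulNmx mulmxDr !mulmxA.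
rewrite -!addrA; congr (_ + _); rewrite addrC; congr (_ + _).
by rewrite [in RHS](addrC (- _)) addNKr.
Qed.

(** The covariant derivative of an alternating form is alternating: both the derivative part and the
    connection part change sign under transposition. *)
Lemma nablaJ_antisym i p a : dom N i p ->
  (nablaJ i p a *m g i p)^T = - (nablaJ i p a *m g i p).
Proof.
move=> ip; rewrite nablaJ_g//; set B := J i p *m g i p.
have BT : B^T = - B.
  exact: hermitian_antisym (metric_trmx ip) (kahler_JJ ip) (kahler_JgJ ip).
have PE b c : (pd_mx (J i) i a p *m g i p + J i p *m pd_mx (g i) i a p) b c =
    - pd i a (fun q => kahler_form J g i q b c) p.
  by rewrite pd_kahler_form// opprK [LHS]mxE.
have PT : (pd_mx (J i) i a p *m g i p + J i p *m pd_mx (g i) i a p)^T =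
    - (pd_mx (J i) i a p *m g i p + J i p *m pd_mx (g i) i a p).
  apply/matrixP => b c; rewrite [LHS]mxE [RHS]mxE !PE opprK.
  transitivity (pd i a (fun q => - kahler_form J g i q c b) p).
    rewrite (is_pdE (is_pdN (is_pd_kahler_form a c b ip))).
    by rewrite pd_kahler_form.
  apply: pd_ext => // q iq.
  have /matrixP/(_ b c) := hermitian_antisym
    (metric_trmx iq) (kahler_JJ iq) (kahler_JgJ iq).
  rewrite /kahler_form (hermitian_gJT (kahler_JJ iq) (kahler_JgJ iq)).
  by rewrite [LHS]mxE [RHS]mxE => E; rewrite mxE E [RHS]mxE opprK.
clearbody B; rewrite [LHS]raddfB [X in X - _]raddfB /= PT.
rewrite !trmx_mul BT trmxK mulNmx mulmxN.
by rewrite !opprD !opprK addrAC.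
Qed.

(** Antisymmetry of J g gives both connection terms the same shape, so that they can be matched in a
    cyclic sum. *)
Lemma nablaJ_gE i p a b c : dom N i p -> (nablaJ i p a *m g i p) b c =
  - pd i a (fun q => kahler_form J g i q b c) p
  - \sum_e christoffel g i a b e p * (J i p *m g i p) e c
  + \sum_e christoffel g i a c e p * (J i p *m g i p) e b.
Proof.
move=> ip; rewrite nablaJ_g// pd_kahler_form// opprK.
have BT x y : (J i p *m g i p) x y = - (J i p *m g i p) y x.
  have /matrixP/(_ y x) :=
    hermitian_antisym (metric_trmx ip) (kahler_JJ ip) (kahler_JgJ ip).
  by rewrite [LHS]mxE [RHS]mxE.
move: (J i p *m g i p) BT => B BT.
rewrite [LHS]mxE [X in X + _]mxE [X in X + _ + _]mxE.
congr (_ + _ + _); rewrite [LHS]mxE [X in - X]mxE.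
  by congr (- _); apply: eq_bigr => e _; rewrite mxE.
rewrite -sumrN; apply: eq_bigr => e _.
by rewrite !mxE (BT b) mulNr opprK mulrC.
Qed.

(** For a torsion-free connection the cyclic sum of nabla omega is the cyclic sum of partial
    derivatives: the six connection terms cancel in pairs by symmetry of Gamma. Closedness on the
    commuting coordinate fields finishes. *)
Lemma nablaJ_cyclic i p a b c : dom N i p ->
  (nablaJ i p a *m g i p) b c + (nablaJ i p b *m g i p) c a
  + (nablaJ i p c *m g i p) a b = 0.
Proof.
move=> ip; apply: etrans (congr2 +%R (congr2 +%R (nablaJ_gE a b c ip)
  (nablaJ_gE b c a ip)) (nablaJ_gE c a b ip)) _.
pose S x y z := \sum_e christoffel g i x y e p * (J i p *m g i p) e z.
have G x y z : S x y z = S y x z.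
  by apply: eq_bigr => e _; rewrite (christoffelC metric_g).
rewrite -!/(S _ _ _) (G b a) (G c a) (G c b).
case: kahler => _ _ _ _ closed.
have := closed i (coord_field a) (coord_field b) (coord_field c).
have sc x : smooth_lfield i (coord_field x).
  by move=> y; exact: smooth_on_cst.
move=> /(_ (sc a) (sc b) (sc c) p ip); rewrite !vder_coord.
have A x y : app2 i (kahler_form J g) (coord_field x) (coord_field y) =
    fun q => kahler_form J g i q x y by apply/funext => q; exact: app2_coord.
have L x y z : app2 i (kahler_form J g) (lie i (coord_field x) (coord_field y))
    (coord_field z) p = 0.
  by rewrite /app2 lie_coord !mul0mx mxE.
rewrite !A !L; lra.
Qed.

Lemma kahler_J_div0 i p b : dom N i p ->
  \sum_k (pd_mx (J i) i k p b k - \sum_e christoffel g i k b e p * J i p e k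
    + \sum_e J i p b e * christoffel g i k e k p) = 0.
Proof.
move=> ip; rewrite -[RHS](hermitian_div0 (metric_trmx ip) (metric_unit metric_g ip)
  (kahler_JJ ip) (kahler_JgJ ip) (fun a => nablaJ_J a ip)
  (fun a => nablaJ_antisym a ip) (fun a b c => nablaJ_cyclic a b c ip) b).
apply: eq_bigr => k _; rewrite [RHS]mxE [X in _ = X + _]mxE [X in _ = _ + X + _]mxE.
congr (_ - _ + _).
  by rewrite [RHS]mxE; apply: eq_bigr => e _; rewrite mxE.
by rewrite [RHS]mxE; apply: eq_bigr => e _; rewrite mxE.
Qed.

End almost_hermitian.

(** * The Sasakian lift *)

Section lift_structure.
Context {R : realType} {m : nat} (N : manifold R m).
Variables (J g : mfield N) (tau : rfield N).
Hypothesis kahler : is_kahler J g.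
Hypothesis tau_form : is_one_form tau.
Let M := line_manifold N.
Let gL : mfield M := lift_metric g tau.
Let eta : rfield M := lift_eta tau.
Let phi : mfield M := lift_phi J tau.
Implicit Types (i j : atlas N) (p : M) (a b k : 'I_m) (z : 'I_1).

Lemma dpi2T : (dpi2 : 'M[R]_(1 + m, m))^T = row_mx 0 1%:M.
Proof. by rewrite /dpi2 tr_col_mx trmx0 trmx1. Qed.

Lemma lift_etaE i p : eta i p = row_mx 1%:M (tau i p.2).
Proof.
by rewrite /eta /lift_eta dpi2T mul_mx_row mulmx0 mulmx1 add_row_mx addr0 add0r.
Qed.

Lemma lift_mx_block i (q : N) : lift_mx tau i q = row_mx (- (tau i q)^T) 1%:M.
Proof.
by rewrite /lift_mx mul_mx_row mulmx1 mulmx0 opp_row_mx add_row_mx add0r subr0.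
Qed.

Lemma lift_metric_block i p : gL i p =
  block_mx 1%:M (tau i p.2) (tau i p.2)^T
    (g i p.2 + (tau i p.2)^T *m tau i p.2).
Proof.
rewrite /gL /lift_metric -/eta lift_etaE dpi2T tr_row_mx trmx1 mul_col_row.
rewrite !mul1mx mulmx1 /dpi2 mul_col_mx mul_col_row !mul0mx !mul1mx !mulmx0 mulmx1.
by rewrite add_block_mx !addr0 (addrC (g _ _)).
Qed.

Lemma lift_phi_block i p : phi i p =
  block_mx 0 0 (- (J i p.2 *m (tau i p.2)^T)) (J i p.2).
Proof.
rewrite /phi /lift_phi lift_mx_block /dpi2 mul_col_mx mul_col_row.
by rewrite mul0mx mul1mx !mul0mx mulmxN mulmx1.
Qed.

Lemma lift_eta_r i p b : eta i p 0 (rshift 1 b) = tau i p.2 0 b.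
Proof. by rewrite lift_etaE row_mxEr. Qed.

Lemma lift_eta_l i p z : eta i p 0 (lshift m z) = 1.
Proof. by rewrite lift_etaE row_mxEl ord1 mxE. Qed.

Lemma lift_metric_ll i p z z' : gL i p (lshift m z) (lshift m z') = 1.
Proof. by rewrite lift_metric_block block_mxEul !ord1 mxE. Qed.

Lemma lift_metric_lr i p z b : gL i p (lshift m z) (rshift 1 b) = tau i p.2 0 b.
Proof. by rewrite lift_metric_block block_mxEur ord1. Qed.

Lemma lift_metric_rl i p a z : gL i p (rshift 1 a) (lshift m z) = tau i p.2 0 a.
Proof. by rewrite lift_metric_block block_mxEdl ord1 mxE. Qed.

Lemma lift_metric_rr i p a b : gL i p (rshift 1 a) (rshift 1 b) =
  g i p.2 a b + tau i p.2 0 a * tau i p.2 0 b.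
Proof. by rewrite lift_metric_block block_mxEdr !mxE big_ord1 mxE. Qed.

Lemma smooth_on_tau i b : smooth_on i (fun q => tau i q 0 b).
Proof. by case: tau_form. Qed.

Lemma smooth_on_lift_eta i (b : 'I_(1 + m)) :
  @smooth_on R _ M i (fun p => eta i p 0 b).
Proof.
case: (split_ordP b) => c ->.
  rewrite (_ : (fun p => _) = fun=> 1); first exact: smooth_on_cst.
  by apply/funext => p; rewrite lift_eta_l.
rewrite (_ : (fun p => _) = fun p : M => tau i p.2 0 c).
  exact: (smooth_on_line (smooth_on_tau i c)).
by apply/funext => p; rewrite lift_eta_r.
Qed.

Lemma lift_jac_dpi2 i j p : @jac R _ M i j p *m dpi2 = dpi2 *m jac i j p.2.
Proof.
rewrite jac_line /dpi2 mul_block_col mul_col_mx !mul0mx !mulmx0 mul1mx mulmx1.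
by rewrite addr0 add0r.
Qed.

Lemma lift_eta_jac i j p : dom M i p -> dom M j p ->
  eta i p = eta j p *m (@jac R _ M i j p)^T.
Proof.
move=> ip jp; rewrite !lift_etaE jac_line tr_block_mx trmx1 !trmx0 mul_row_block.
rewrite !mulmx0 mulmx1 addr0 add0r.
by case: tau_form => _ /(_ i j p.2 ip jp) ->.
Qed.

Lemma lift_mx_jac i j p : dom M i p -> dom M j p ->
  lift_mx tau i p.2 *m @jac R _ M i j p = jac i j p.2 *m lift_mx tau j p.2.
Proof.
move=> ip jp; rewrite !lift_mx_block jac_line mul_row_block mul_mx_row.
rewrite !mulmx0 mul1mx !mulmx1 addr0 add0r; congr row_mx.
by case: tau_form => _ /(_ i j p.2 ip jp) ->; rewrite trmx_mul trmxK mulmxN.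
Qed.

Lemma lift_eta_form : is_one_form eta.
Proof. by split=> [i b|i j p]; [exact: smooth_on_lift_eta|exact: lift_eta_jac]. Qed.

Lemma lift_xi_vector_field : is_vector_field (lift_xi N).
Proof.
split=> [i b|i j p ip jp]; last first.
  by rewrite /lift_xi jac_line mul_row_block !mulmx0 mulmx1 mul0mx !addr0.
by rewrite /lift_xi; exact: smooth_on_cst.
Qed.

Lemma lift_phi_tensor : is_tensor11 phi.
Proof.
split=> [i a b|i j p ip jp]; last first.
  rewrite /phi /lift_phi -(mulmxA _ (lift_mx _ _ _)) lift_mx_jac//.
  rewrite 2![in RHS]mulmxA lift_jac_dpi2 -!mulmxA; congr (_ *m _).
  by case: kahler => _ [_ JT] _ _ _; rewrite !mulmxA JT.
have sJ c d : @smooth_on R m N i (fun q => J i q c d) by case: kahler => _ [].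
case: (split_ordP a) => c ->; case: (split_ordP b) => d ->.
- rewrite (_ : (fun p => _) = fun=> 0); first exact: smooth_on_cst.
  by apply/funext => p; rewrite lift_phi_block block_mxEul mxE.
- rewrite (_ : (fun p => _) = fun=> 0); first exact: smooth_on_cst.
  by apply/funext => p; rewrite lift_phi_block block_mxEur mxE.
- rewrite (_ : (fun p => _) =
      fun p : M => -1 * \sum_k J i p.2 c k * tau i p.2 0 k).
    apply: (@smooth_on_line R m N i (fun q => -1 * \sum_k J i q c k * tau i q 0 k)).
    apply: smooth_onM; first exact: smooth_on_cst.
    apply: smooth_on_sum => k _; apply: smooth_onM => //; exact: smooth_on_tau.
  apply/funext => p; rewrite lift_phi_block block_mxEdl !mxE mulN1r ord1.
  by congr (- _); apply: eq_bigr => k _; rewrite mxE.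
- rewrite (_ : (fun p => _) = fun p : M => J i p.2 c d).
    exact: (smooth_on_line (sJ c d)).
  by apply/funext => p; rewrite lift_phi_block block_mxEdr.
Qed.

Let metric_g : is_metric g. Proof. by case: kahler. Qed.

Lemma lift_metric_tensor : is_tensor02 gL.
Proof.
split=> [i a b|i j p ip jp]; last first.
  rewrite /gL /lift_metric -/eta (lift_eta_jac ip jp).
  rewrite mulmxDr mulmxDl trmx_mul trmxK !mulmxA; congr (_ + _).
  rewrite lift_jac_dpi2 -!mulmxA -trmx_mul lift_jac_dpi2 trmx_mul !mulmxA.
  case: metric_g => -[_ /(_ i j p.2 ip jp) ->] _; by rewrite !mulmxA.
rewrite (_ : (fun p => _) = fun p : M => eta i p 0 a * eta i p 0 b
    + (dpi2 *m g i p.2 *m dpi2^T) a b).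
  apply: smooth_onD; first by apply: smooth_onM; exact: smooth_on_lift_eta.
  apply: (@smooth_on_line R m N i (fun q => (dpi2 *m g i q *m dpi2^T) a b)).
  rewrite (_ : (fun q => _) = 
      fun q => \sum_k (\sum_l dpi2 a l * g i q l k) * dpi2^T k b).
    apply: smooth_on_sum => k _; apply: smooth_onM; last exact: smooth_on_cst.
    apply: smooth_on_sum => l _; apply: smooth_onM; first exact: smooth_on_cst.
    exact: metric_smooth.
  by apply/funext => q; rewrite mxE; apply: eq_bigr => k _; rewrite mxE.
apply/funext => p; rewrite /gL /lift_metric [LHS]mxE; congr (_ + _).
by rewrite mxE big_ord1 mxE.
Qed.

(** The quadratic form is eta(v)^2 + g(d pi_2 v, d pi_2 v). If the projection of [v] vanishes, [v]
    is a multiple of xi, on which eta is injective. *)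
Lemma lift_metric_metric : is_metric gL.
Proof.
split; first exact: lift_metric_tensor.
move=> i p ip; have [_ /(_ i p.2 ip)[gT gpos]] := metric_g.
split=> [|v v0].
  by rewrite /gL /lift_metric linearD /= !trmx_mul !trmxK gT mulmxA.
rewrite /gL /lift_metric -/eta mulmxDr mulmxDl mxE.
rewrite !mulmxA -(mulmxA _ dpi2^T) -trmx_mul.
have -> : v *m (eta i p)^T *m eta i p *m v^T =
    (v *m (eta i p)^T) *m (v *m (eta i p)^T)^T by rewrite trmx_mul trmxK !mulmxA.
rewrite [X in X + _]mxE big_ord1 [X in _ * X + _]mxE -expr2.
have [v20|v20] := eqVneq (v *m dpi2) 0; last first.
  by rewrite ltr_wpDl ?sqr_ge0// gpos.
rewrite v20 !mul0mx [X in _ + X]mxE addr0 exprn_even_gt0 //=.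
apply: contraNneq v0 => ve.
rewrite -(hsubmxK v) in ve v20 *.
move: v20; rewrite /dpi2 mul_row_col mulmx0 mulmx1 add0r => v20.
move: ve; rewrite lift_etaE v20 tr_row_mx mul_row_col mul0mx addr0 trmx1 mulmx1.
by move=> l0; rewrite (_ : lsubmx v = 0) ?row_mx0//;
  apply/rowP => z; rewrite !ord1 l0 mxE.
Qed.

(** For the last identity, [lift_mx] takes values in the kernel of eta and is isometric. Hence phi
    g^L phi^T reduces to the pullback of J g J^T = g, which is g^L with its eta part removed. *)
Lemma lift_almost_contact : is_almost_contact_metric phi (lift_xi N) eta gL.
Proof.
split.
- exact: lift_phi_tensor.
- exact: lift_xi_vector_field.
- exact: lift_eta_form.
- exact: lift_metric_metric.
move=> i p ip; have JJ := kahler_JJ kahler ip; split.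
- rewrite lift_phi_block mulmx_block !mul0mx !mulmx0 !add0r JJ lift_etaE /lift_xi.
  rewrite mulmxN mulmxA JJ mulNmx mul1mx opprK tr_row_mx trmx1 mul_col_row.
  rewrite !mulmx0 !mulmx1.
  rewrite scalar_mx_block opp_block_mx add_block_mx !oppr0 !addr0 !add0r.
  by rewrite addNr.
- by rewrite lift_etaE /lift_xi tr_row_mx mul_row_col mul0mx addr0 trmx1 mulmx1.
have Leta : lift_mx tau i p.2 *m (eta i p)^T = 0.
  by rewrite lift_mx_block lift_etaE tr_row_mx mul_row_col trmx1 mulmx1
    mul1mx addNr.
have Ldpi : lift_mx tau i p.2 *m dpi2 = 1%:M.
  by rewrite lift_mx_block /dpi2 mul_row_col mulmx0 mulmx1 add0r.
have LgL : lift_mx tau i p.2 *m gL i p *m (lift_mx tau i p.2)^T = g i p.2.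
  rewrite /gL /lift_metric -/eta mulmxDr mulmxDl !mulmxA Leta !mul0mx add0r.
  by rewrite Ldpi mul1mx -mulmxA -trmx_mul Ldpi trmx1 mulmx1.
rewrite [RHS](_ : _ = dpi2 *m g i p.2 *m dpi2^T); last first.
  by rewrite /gL /lift_metric addrAC subrr add0r.
rewrite -[in RHS](kahler_JgJ kahler ip) -LgL /phi /lift_phi !trmx_mul.
by rewrite !mulmxA.
Qed.

End lift_structure.

(** * Christoffel symbols and Ricci tensor of the lifted metric *)

Section lift_ricci.
Context {R : realType} {m : nat} (N : manifold R m).
Variables (J g : mfield N) (tau : rfield N).
Hypothesis kahler : is_kahler J g.
Hypothesis tau_form : is_one_form tau.
Hypothesis omega_dtau : is_ext_d tau (kahler_form J g).
Let M := line_manifold N.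
Let gL : mfield M := lift_metric g tau.
Local Notation pdM := (@pd R (1 + m) M).
Implicit Types (i j : atlas N) (p : M) (a b c k : 'I_m) (z : 'I_1).

Let metric_g : is_metric g. Proof. by case: kahler. Qed.
Let metric_gL : is_metric gL. Proof. exact: lift_metric_metric kahler tau_form. Qed.

Let dtau i a b (q : N) := pd i a (fun x => tau i x 0 b) q.
Let sym_dtau i a b (q : N) := 2^-1 * (dtau i a b q + dtau i b a q).
Let Gam i a b k (q : N) := christoffel g i a b k q.
Let u i b (q : N) := \sum_k tau i q 0 k * J i q b k.
Let K i a b k (q : N) :=
  Gam i a b k q - (tau i q 0 b * J i q a k + tau i q 0 a * J i q b k).
Let K0 i a b (q : N) := sym_dtau i a b q - \sum_k tau i q 0 k * K i a b k q.

(** Evaluate d tau on coordinate fields, whose bracket is zero. The factor 2 cancels the one half in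
    [0b, c], so that this first-kind symbol is exactly omega_bc. *)
Lemma kahler_form_dtau i (q : N) a b : dom N i q ->
  2 * kahler_form J g i q a b = dtau i a b q - dtau i b a q.
Proof.
move=> iq.
have sc x : @smooth_lfield R m N i (coord_field x).
  by move=> y; exact: smooth_on_cst.
have := omega_dtau (sc a) (sc b) iq.
have E x : app1 i tau (coord_field x) = fun y => tau i y 0 x.
  by apply/funext => y; rewrite /app1 /coord_field -rowE !mxE.
rewrite !vder_coord !E app2_coord => ->.
by rewrite /app1 lie_coord mul0mx mxE subr0.
Qed.

(* The row (v0, v) times g^L is (s, s tau + v g) with s = v0 + v . tau, so the
   Christoffel symbols are found without inverting g^L. *)
Lemma lift_christoffel_unique i p (A B : 'I_(1 + m)) (v0 : R) (v : 'I_m -> R) :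
    dom M i p ->
    (forall z, christoffel1 gL i A B (lshift m z) p =
      v0 + \sum_k v k * tau i p.2 0 k) ->
    (forall c, christoffel1 gL i A B (rshift 1 c) p =
      (v0 + \sum_k v k * tau i p.2 0 k) * tau i p.2 0 c
      + \sum_k v k * g i p.2 k c) ->
  (forall z, christoffel gL i A B (lshift m z) p = v0) /\
  (forall k, christoffel gL i A B (rshift 1 k) p = v k).
Proof.
move=> ip E0 Ec.
have U : forall C, christoffel gL i A B C p =
    (row_mx v0%:M (\row_k v k) : 'rV[R]_(1 + m)) 0 C.
  apply: (christoffel_unique metric_gL ip) => C.
  rewrite mxE big_split_ord big_ord1 /= row_mxEl mxE mulr1n.
  case: (split_ordP C) => c ->.
    rewrite E0 lift_metric_ll mulr1; congr (_ + _); apply: eq_bigr => k _.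
    by rewrite row_mxEr mxE lift_metric_rl.
  rewrite Ec lift_metric_lr mulrDl -addrA; congr (_ + _).
  rewrite mulr_suml -big_split; apply: eq_bigr => k _ /=.
  by rewrite row_mxEr mxE lift_metric_rr; ring.
split=> k; rewrite U; first by rewrite row_mxEl ord1 mxE.
by rewrite row_mxEr mxE.
Qed.

Lemma pd_lift_metric_l i p z (A B : 'I_(1 + m)) :
  pdM i (lshift m z) (fun q => gL i q A B) p = 0.
(* The value 0 of t is arbitrary: [lift_metric] reads only the second component of the point. *)
Proof. exact: (pd_line_l i z (fun x => gL i (0, x) A B)). Qed.

Lemma pd_lift_metric_ll i p (C : 'I_(1 + m)) z z' :
  pdM i C (fun q => gL i q (lshift m z) (lshift m z')) p = 0.
Proof.
rewrite (_ : (fun q => _) = fun=> 1) ?pd_cst//.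
by apply/funext => q; rewrite lift_metric_ll.
Qed.

Lemma pd_lift_metric_lr i p c z b :
  pdM i (rshift 1 c) (fun q => gL i q (lshift m z) (rshift 1 b)) p = dtau i c b p.2.
Proof.
rewrite (_ : (fun q => _) = fun q : M => tau i q.2 0 b); last first.
  by apply/funext => q; rewrite lift_metric_lr.
exact: (pd_line_r i c (fun x => tau i x 0 b)).
Qed.

Lemma pd_lift_metric_rl i p c z b :
  pdM i (rshift 1 c) (fun q => gL i q (rshift 1 b) (lshift m z)) p = dtau i c b p.2.
Proof.
rewrite (_ : (fun q => _) = fun q : M => tau i q.2 0 b); last first.
  by apply/funext => q; rewrite lift_metric_rl.
exact: (pd_line_r i c (fun x => tau i x 0 b)).
Qed.

Lemma is_pd_tau i (q : N) a b : dom N i q ->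
  is_pd i a (fun x => tau i x 0 b) q (dtau i a b q).
Proof. by move=> iq; apply: is_pd_pd => //; exact: smooth_on_tau. Qed.

Lemma pd_lift_metric_rr i p c a b : dom M i p ->
  pdM i (rshift 1 c) (fun q => gL i q (rshift 1 a) (rshift 1 b)) p =
  pd i c (fun x => g i x a b) p.2 + (dtau i c a p.2 * tau i p.2 0 b
    + tau i p.2 0 a * dtau i c b p.2).
Proof.
move=> ip; rewrite (_ : (fun q => _) =
    fun q : M => g i q.2 a b + tau i q.2 0 a * tau i q.2 0 b); last first.
  by apply/funext => q; rewrite lift_metric_rr.
rewrite (pd_line_r i c (fun x => g i x a b + tau i x 0 a * tau i x 0 b)).
apply: is_pdE; apply: is_pdD; first exact (is_pd_metric kahler c a b ip).
by apply: is_pdM => //; exact: is_pd_tau.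
Qed.

Lemma sum_J_metric i (q : N) a b : dom N i q ->
  \sum_k J i q a k * g i q k b = - kahler_form J g i q a b.
Proof.
move=> iq; rewrite /kahler_form.
rewrite (hermitian_gJT (kahler_JJ kahler iq) (kahler_JgJ kahler iq)).
by rewrite [in RHS]mxE opprK mxE.
Qed.

Lemma lift_christoffel_ll i p z z' : dom M i p ->
  (forall z'', christoffel gL i (lshift m z) (lshift m z') (lshift m z'') p = 0)
  /\ (forall k, christoffel gL i (lshift m z) (lshift m z') (rshift 1 k) p = 0).
Proof.
move=> ip; apply: (lift_christoffel_unique (v := fun=> 0)) => // [z''|c].
  rewrite /christoffel1 !pd_lift_metric_l big1 => [|k _]; last by rewrite mul0r.
  by rewrite subr0 !addr0 mulr0.
rewrite /christoffel1 !pd_lift_metric_l pd_lift_metric_ll.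
by rewrite !big1 => [|k _|k _]; rewrite ?mul0r// subr0 !addr0 mulr0 mul0r.
Qed.

(** These are the components of - (J d_b)^L. It lies in the kernel of eta, so the number s of
    [lift_christoffel_unique] is 0 here. *)
Lemma lift_christoffel_lr i p z b : dom M i p ->
  (forall z', christoffel gL i (lshift m z) (rshift 1 b) (lshift m z') p =
     u i b p.2)
  /\ (forall k, christoffel gL i (lshift m z) (rshift 1 b) (rshift 1 k) p =
     - J i p.2 b k).
Proof.
move=> ip; apply: (lift_christoffel_unique (v := fun k => - J i p.2 b k)) => //.
  move=> z'; rewrite /christoffel1 !pd_lift_metric_l pd_lift_metric_ll.
  rewrite subr0 !addr0 mulr0 /u -big_split big1// => k _ /=; ring.
move=> c; rewrite /u -big_split big1 => [|k _]; last by rewrite /=; ring.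
rewrite mul0r add0r /christoffel1 pd_lift_metric_l pd_lift_metric_lr.
rewrite pd_lift_metric_lr add0r -kahler_form_dtau//.
under eq_bigr do rewrite mulNr; rewrite sumrN sum_J_metric// opprK.
by field.
Qed.

Lemma lift_christoffel_rl i p z b : dom M i p ->
  (forall z', christoffel gL i (rshift 1 b) (lshift m z) (lshift m z') p =
     u i b p.2)
  /\ (forall k, christoffel gL i (rshift 1 b) (lshift m z) (rshift 1 k) p =
     - J i p.2 b k).
Proof.
move=> ip; have [E0 E] := lift_christoffel_lr z b ip.
by split=> x; rewrite (christoffelC metric_gL).
Qed.

Lemma lift_christoffel_rr i p a b : dom M i p ->
  (forall z, christoffel gL i (rshift 1 a) (rshift 1 b) (lshift m z) p =
     K0 i a b p.2)
  /\ (forall k, christoffel gL i (rshift 1 a) (rshift 1 b) (rshift 1 k) p =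
     K i a b k p.2).
Proof.
(* [K0] is chosen so that s, which is the lowered symbol [ab, 0], equals the symmetrised derivative
   of tau. *)
move=> ip; have Es : K0 i a b p.2 + \sum_k K i a b k p.2 * tau i p.2 0 k =
    sym_dtau i a b p.2.
  rewrite /K0 addrC [X in _ + (_ - X)](_ : _ =
    \sum_k K i a b k p.2 * tau i p.2 0 k) ?subrKC//.
  by apply: eq_bigr => k _; rewrite mulrC.
apply: lift_christoffel_unique => // [z|c]; rewrite Es.
  rewrite /christoffel1 !pd_lift_metric_rl pd_lift_metric_l subr0.
  by rewrite /sym_dtau.
have -> : \sum_k K i a b k p.2 * g i p.2 k c = christoffel1 g i a b c p.2
    + tau i p.2 0 b * kahler_form J g i p.2 a c
    + tau i p.2 0 a * kahler_form J g i p.2 b c.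
  rewrite -[kahler_form J g i p.2 a c]opprK -sum_J_metric//.
  rewrite -[kahler_form J g i p.2 b c]opprK -sum_J_metric//.
  rewrite -christoffelK// !mulrN !mulr_sumr -!sumrN -!big_split /=.
  by apply: eq_bigr => k _; rewrite /K /Gam; ring.
have H x y := kahler_form_dtau x y (ip : dom N i p.2).
have -> : kahler_form J g i p.2 a c = 2^-1 * (dtau i a c p.2 - dtau i c a p.2).
  by rewrite -H; field.
have -> : kahler_form J g i p.2 b c = 2^-1 * (dtau i b c p.2 - dtau i c b p.2).
  by rewrite -H; field.
rewrite /christoffel1 (pd_lift_metric_rr a b c ip) (pd_lift_metric_rr b a c ip).
rewrite (pd_lift_metric_rr c a b ip).
rewrite /sym_dtau; move: (pd i a _ _) (pd i b _ _) (pd i c _ _)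
  (tau i _ 0 a) (tau i _ 0 b) (tau i _ 0 c) (dtau i a b _) (dtau i b a _)
  (dtau i a c _) (dtau i c a _) (dtau i b c _) (dtau i c b _) => *; ring.
Qed.

Lemma kahler_tr0 i (q : N) : dom N i q -> \tr (J i q) = 0.
Proof.
move=> iq; exact: hermitian_tr0 (metric_unit metric_g iq)
  (kahler_JJ kahler iq) (kahler_JgJ kahler iq).
Qed.

Lemma lift_christoffel_trace_l i p z : dom M i p ->
  \sum_C christoffel gL i C (lshift m z) C p = 0.
Proof.
move=> ip; rewrite big_split_ord big_ord1 /= (lift_christoffel_ll _ _ ip).1 add0r.
under eq_bigr do rewrite (lift_christoffel_rl _ _ ip).2.
by rewrite sumrN -/(\tr (J i p.2)) kahler_tr0// oppr0.
Qed.

Lemma lift_christoffel_trace_r i p b : dom M i p ->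
  \sum_C christoffel gL i C (rshift 1 b) C p = \sum_k Gam i k b k p.2.
Proof.
move=> ip; rewrite big_split_ord big_ord1 /= (lift_christoffel_lr _ _ ip).1.
under eq_bigr do rewrite (lift_christoffel_rr _ _ ip).2.
exact: (lift_trace (fun k => tau i p.2 0 k) (fun a b k => Gam i a b k p.2)
  (kahler_tr0 ip)).
Qed.

(** The symbols of the lift are known only on the chart domain, where they depend on the base point
    alone; this suffices to differentiate them. *)
Lemma pd_lift_l i p z (f : M -> R) (h : N -> R) : dom M i p ->
  (forall q, dom M i q -> f q = h q.2) -> pdM i (lshift m z) f p = 0.
Proof. by move=> ip fh; rewrite (pd_ext _ ip fh) pd_line_l. Qed.

Lemma pd_lift_r i p a (f : M -> R) (h : N -> R) : dom M i p ->
  (forall q, dom M i q -> f q = h q.2) ->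
  pdM i (rshift 1 a) f p = pd i a h p.2.
Proof. by move=> ip fh; rewrite (pd_ext _ ip fh) pd_line_r. Qed.

Lemma pd_lift_christoffel_lr i p z c b k : dom M i p ->
  pdM i (rshift 1 c) (christoffel gL i (lshift m z) (rshift 1 b) (rshift 1 k)) p =
  - pd i c (fun q => J i q b k) p.2.
Proof.
move=> ip; have -> := @pd_lift_r i p c _ (fun q => - J i q b k) ip
  (fun q iq => (lift_christoffel_lr z b iq).2 k).
exact: is_pdE (is_pdN (is_pd_J kahler c b k (ip : dom N i p.2))).
Qed.

Lemma pd_lift_christoffel_rr i p c a b k : dom M i p ->
  pdM i (rshift 1 c) (christoffel gL i (rshift 1 a) (rshift 1 b) (rshift 1 k)) p =
  pd i c (christoffel g i a b k) p.2
  - (dtau i c b p.2 * J i p.2 a k + tau i p.2 0 b * pd i c (fun q => J i q a k) p.2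
    + (dtau i c a p.2 * J i p.2 b k
       + tau i p.2 0 a * pd i c (fun q => J i q b k) p.2)).
Proof.
move=> ip; have iq : dom N i p.2 by [].
have -> := @pd_lift_r i p c _ (K i a b k) ip
  (fun q iq => (lift_christoffel_rr a b iq).2 k).
apply: is_pdE; apply: is_pdD; first exact (is_pd_christoffel metric_g a b k c iq).
by apply: is_pdN; apply: is_pdD; apply: (is_pdM iq);
  [exact (is_pd_tau c _ iq) | exact (is_pd_J kahler c _ _ iq)
  |exact (is_pd_tau c _ iq) | exact (is_pd_J kahler c _ _ iq)].
Qed.

Lemma pd_lift_trace_l i p z (A : 'I_(1 + m)) : dom M i p ->
  pdM i A (fun q => \sum_C christoffel gL i C (lshift m z) C q) p = 0.
Proof.
move=> ip; rewrite -[RHS](@pd_cst R _ M i A 0 p); apply: (pd_ext _ ip) => q iq.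
exact: lift_christoffel_trace_l.
Qed.

(** All G^C_00 vanish and so does the trace G^C_C0; only the quadratic term with horizontal indices
    survives, and it equals - tr(J^2). *)
Lemma lift_ricci_ll i p z z' : dom M i p ->
  ricci gL i p (lshift m z) (lshift m z') = m%:R.
Proof.
move=> ip; rewrite (ricci_traceE metric_gL _ _ ip) pd_lift_trace_l// subr0.
rewrite big1 => [|C _]; last first.
  case: (split_ordP C) => c ->.
    exact (@pd_lift_l i p c _ (fun=> 0) ip
      (fun q iq => (lift_christoffel_ll z z' iq).1 c)).
  rewrite (@pd_lift_r i p c _ (fun=> 0) ip
    (fun q iq => (lift_christoffel_ll z z' iq).2 c)).
  exact: pd_cst.
have [E0 Ek] := lift_christoffel_ll z z' ip.
rewrite big1 => [|C _]; last by case: (split_ordP C) => c ->; rewrite ?E0 ?Ek mul0r.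
rewrite addr0 sub0r -(lift_ricci_vertical (kahler_JJ kahler (ip : dom N i p.2))).
congr (- _); rewrite big_split_ord big_ord1 /= big1 ?add0r => [|C _]; last first.
  have [F0 Fk] := lift_christoffel_ll ord0 z' ip.
  by case: (split_ordP C) => c ->; rewrite ?F0 ?Fk mul0r.
apply: eq_bigr => k _; rewrite big_split_ord big_ord1 /=.
rewrite (lift_christoffel_ll _ _ ip).2 mulr0 add0r; apply: eq_bigr => e _.
by rewrite (lift_christoffel_rl _ _ ip).2 (lift_christoffel_lr _ _ ip).2.
Qed.

Lemma lift_ricci_lr i p z b : dom M i p ->
  ricci gL i p (lshift m z) (rshift 1 b) = m%:R * tau i p.2 0 b.
Proof.
move=> ip; have iq : dom N i p.2 by [].
rewrite (ricci_traceE metric_gL _ _ ip).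
rewrite (@pd_lift_l i p z _ (fun q => \sum_k Gam i k b k q) ip
  (fun q iq => lift_christoffel_trace_r b iq)) subr0.
have [E0 Ek] := lift_christoffel_lr z b ip.
have -> : \sum_C pdM i C (christoffel gL i (lshift m z) (rshift 1 b) C) p =
    \sum_k - pd_mx (J i) i k p.2 b k.
  rewrite big_split_ord big_ord1 /= (@pd_lift_l i p ord0 _ (u i b) ip
    (fun q iq => (lift_christoffel_lr z b iq).1 ord0)) add0r.
  by apply: eq_bigr => k _; rewrite pd_lift_christoffel_lr// mxE.
have -> : \sum_E christoffel gL i (lshift m z) (rshift 1 b) E p *
      \sum_C christoffel gL i C E C p =
    \sum_e - J i p.2 b e * \sum_k Gam i k e k p.2.
  rewrite big_split_ord big_ord1 /= lift_christoffel_trace_l// mulr0 add0r.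
  by apply: eq_bigr => e _; rewrite Ek lift_christoffel_trace_r.
have -> : \sum_C \sum_E christoffel gL i C (rshift 1 b) E p *
      christoffel gL i (lshift m z) E C p =
    \sum_e - J i p.2 b e * u i e p.2
    + \sum_k \sum_e K i k b e p.2 * - J i p.2 e k.
  rewrite big_split_ord big_ord1 /=; congr (_ + _).
    rewrite big_split_ord big_ord1 /= (lift_christoffel_ll _ _ ip).1 mulr0 add0r.
    apply: eq_bigr => e _.
    by rewrite (lift_christoffel_lr _ b ip).2 (lift_christoffel_lr _ e ip).1.
  apply: eq_bigr => k _.
  rewrite big_split_ord big_ord1 /= (lift_christoffel_ll _ _ ip).2 mulr0 add0r.
  apply: eq_bigr => e _.
  by rewrite (lift_christoffel_rr k b ip).2 (lift_christoffel_lr _ e ip).2.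
exact (lift_ricci_mixed (fun k => tau i p.2 0 k)
  (kahler_JJ kahler iq) (fun b => kahler_J_div0 kahler b iq) b).
Qed.

(** Both derivatives compared by [ricci_sym] are zero: G^C_C0 vanishes identically and G^C_Cb does
    not depend on t. *)
Lemma lift_ricci_rl i p z b : dom M i p ->
  ricci gL i p (rshift 1 b) (lshift m z) = m%:R * tau i p.2 0 b.
Proof.
move=> ip; rewrite -(lift_ricci_lr z b ip); apply: (ricci_sym metric_gL ip).
rewrite pd_lift_trace_l//; apply/esym.
exact (@pd_lift_l i p z _ (fun q => \sum_k Gam i k b k q) ip
  (fun q iq => lift_christoffel_trace_r b iq)).
Qed.

Lemma lift_ricci_rr i p a b : dom M i p ->
  ricci gL i p (rshift 1 a) (rshift 1 b) =
  ricci g i p.2 a b - 2 * g i p.2 a b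
  + m%:R * (tau i p.2 0 a * tau i p.2 0 b).
Proof.
move=> ip; have iq : dom N i p.2 by [].
rewrite (ricci_traceE metric_gL _ _ ip) (ricci_traceE metric_g _ _ iq).
rewrite (@pd_lift_r i p a _ (fun q => \sum_k Gam i k b k q) ip
  (fun q iq => lift_christoffel_trace_r b iq)).
have [E0 Ek] := lift_christoffel_rr a b ip.
have -> : \sum_C pdM i C (christoffel gL i (rshift 1 a) (rshift 1 b) C) p =
    \sum_k (pd i k (christoffel g i a b k) p.2
     - (dtau i k b p.2 * J i p.2 a k + tau i p.2 0 b * pd_mx (J i) i k p.2 a k
    + (dtau i k a p.2 * J i p.2 b k
       + tau i p.2 0 a * pd_mx (J i) i k p.2 b k))).
  rewrite big_split_ord big_ord1 /= (@pd_lift_l i p ord0 _ (K0 i a b) ip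
    (fun q iq => (lift_christoffel_rr a b iq).1 ord0)) add0r.
  by apply: eq_bigr => k _; rewrite pd_lift_christoffel_rr// !mxE.
have -> : \sum_E christoffel gL i (rshift 1 a) (rshift 1 b) E p *
      \sum_C christoffel gL i C E C p =
    \sum_e K i a b e p.2 * \sum_k Gam i k e k p.2.
  rewrite big_split_ord big_ord1 /= lift_christoffel_trace_l// mulr0 add0r.
  by apply: eq_bigr => e _; rewrite Ek lift_christoffel_trace_r.
have -> : \sum_C \sum_E christoffel gL i C (rshift 1 b) E p *
      christoffel gL i (rshift 1 a) E C p =
    u i b p.2 * u i a p.2 + \sum_e - J i p.2 b e * K0 i a e p.2
    + \sum_k (K0 i k b p.2 * - J i p.2 a k
              + \sum_e K i k b e p.2 * K i a e k p.2).
  rewrite big_split_ord big_ord1 /=; congr (_ + _).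
    rewrite big_split_ord big_ord1 /=; congr (_ * _ + _).
    - exact: (lift_christoffel_lr _ b ip).1.
    - exact: (lift_christoffel_rl _ a ip).1.
    apply: eq_bigr => e _.
    by rewrite (lift_christoffel_lr _ b ip).2 (lift_christoffel_rr a e ip).1.
  apply: eq_bigr => k _; rewrite big_split_ord big_ord1 /=; congr (_ * _ + _).
  - exact: (lift_christoffel_rr k b ip).1.
  - exact: (lift_christoffel_rl _ a ip).2.
  apply: eq_bigr => e _.
  by rewrite (lift_christoffel_rr k b ip).2 (lift_christoffel_rr a e ip).2.
have dt_S x y : dtau i x y p.2 - sym_dtau i x y p.2 =
    (g i p.2 *m (J i p.2)^T) x y.
  have -> : (g i p.2 *m (J i p.2)^T) x y =
      2^-1 * (dtau i x y p.2 - dtau i y x p.2).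
    by rewrite -kahler_form_dtau//; field.
  by rewrite /sym_dtau; move: (dtau i x y _) (dtau i y x _) => *; field.
have S_sym x y : sym_dtau i x y p.2 = sym_dtau i y x p.2.
  by rewrite /sym_dtau addrC.
have J_div x := kahler_J_div0 kahler x iq.
exact (lift_ricci_horizontal (fun k => tau i p.2 0 k)
  (kahler_JJ kahler iq) (kahler_JgJ kahler iq)
  (metric_trmx kahler iq)
  (fun x y k => christoffelC metric_g x y k iq) S_sym J_div dt_S a b
  (fun k => pd i k (christoffel g i a b k) p.2)
  (pd i a (fun q => \sum_k Gam i k b k q) p.2)).
Qed.

End lift_ricci.

(** * Einstein conditions for the lift *)

Section lift_einstein.
Context {R : realType} {m : nat} (N : manifold R m).
Variables (J g : mfield N) (tau : rfield N) (c : R).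
Hypothesis kahler : is_kahler J g.
Hypothesis tau_form : is_one_form tau.
Hypothesis omega_dtau : is_ext_d tau (kahler_form J g).
Hypothesis einstein_g : einstein_with g c.
Let M := line_manifold N.
Let gL : mfield M := lift_metric g tau.
Let eta : rfield M := lift_eta tau.

Lemma lift_ricci (i : atlas M) (p : M) : dom M i p ->
  ricci gL i p =
  (c - 2) *: gL i p + (m%:R - c + 2) *: ((eta i p)^T *m eta i p).
Proof.
move=> ip; apply/matrixP => A B.
have etaE : ((eta i p)^T *m eta i p) A B = eta i p 0 A * eta i p 0 B.
  by rewrite mxE big_ord1 mxE.
rewrite [RHS]mxE [X in X + _]mxE [X in _ + X]mxE etaE.
case: (split_ordP A) => a ->; case: (split_ordP B) => b ->.
- rewrite (lift_ricci_ll kahler tau_form omega_dtau a b ip).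
  rewrite lift_metric_ll !lift_eta_l; ring.
- rewrite (lift_ricci_lr kahler tau_form omega_dtau a b ip).
  rewrite lift_metric_lr lift_eta_l lift_eta_r; ring.
- rewrite (lift_ricci_rl kahler tau_form omega_dtau b a ip).
  rewrite lift_metric_rl lift_eta_l lift_eta_r; ring.
rewrite (lift_ricci_rr kahler tau_form omega_dtau a b ip).
rewrite lift_metric_rr !lift_eta_r (einstein_g ip) mxE; ring.
Qed.

Lemma lift_eta_einstein : is_eta_einstein (lift_phi J tau) (lift_xi N) eta gL.
Proof.
split; first exact: lift_almost_contact.
exists (fun=> c - 2), (fun=> m%:R - c + 2).
by split=> [i|i|];
  [exact: smooth_on_cst|exact: smooth_on_cst|exact: lift_ricci].
Qed.

(** Since g^L_00 = 1, the entry Ric_00 forces the Einstein constant to be m. A horizontal diagonal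
    entry then reads (c - m - 2) g_aa = 0 with g_aa > 0. Such an entry requires m > 0: for m = 0 the
    lift has a single dimension and is Einstein whatever c is. *)
Lemma lift_einstein : (0 < m)%N -> is_einstein gL <-> c = m%:R + 2.
Proof.
move=> m0; split=> [[d gLd]|cE]; last first.
  exists m%:R => i p ip; rewrite lift_ricci//.
  have -> : c - 2 = m%:R by rewrite cE; ring.
  have -> : m%:R - c + 2 = 0 by rewrite cE; ring.
  by rewrite scale0r addr0.
have [p _] := manifold_nonempty M; have [i ip] := @dom_cover _ _ M p.
have dE A B : ricci gL i p A B = d * gL i p A B by rewrite gLd// mxE.
pose a := Ordinal m0.
have gaa : 0 < g i p.2 a a.
  case: kahler => -[_ /(_ i p.2 ip)[_ pos]] _ _ _ _.
  have := pos 'e_a; rewrite -rowE trmx_delta -colE !mxE; apply.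
  apply/eqP => /matrixP/(_ 0 a); rewrite !mxE !eqxx => /eqP.
  by rewrite oner_eq0.
have := dE (lshift m ord0) (lshift m ord0).
rewrite (lift_ricci_ll kahler tau_form omega_dtau _ _ ip).
rewrite lift_metric_ll mulr1 => md.
have := dE (rshift 1 a) (rshift 1 a).
rewrite (lift_ricci_rr kahler tau_form omega_dtau _ _ ip) lift_metric_rr -md.
rewrite (einstein_g ip) mxE.
move: (g i p.2 a a) (tau i p.2 0 a) gaa => x t x0 E.
have /eqP : (c - m%:R - 2) * x = 0.
  transitivity (c * x - 2 * x + m%:R * (t * t) - m%:R * (x + t * t)); first by ring.
  by rewrite E subrr.
rewrite mulf_eq0 (gt_eqF x0) orbF -addrA -opprD subr_eq0 => /eqP.
by [].
Qed.

End lift_einstein.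

Theorem theorem2 (R : realType) (n : nat) (N : manifold R (2 * n))
    (J g : mfield N) (tau : rfield N) (c : R)
    (kahler : is_kahler J g)
    (tau_form : is_one_form tau)
    (omega_dtau : is_ext_d tau (kahler_form J g))
    (kahler_einstein : einstein_with g c) :
  let M := line_manifold N in
  let phi := lift_phi J tau in
  let xi := lift_xi N in
  let eta := lift_eta tau in
  let gL := lift_metric g tau in
  [/\ is_eta_einstein phi xi eta gL,
      (forall (i : atlas M) (p : M), dom M i p ->
         ricci gL i p = (c - 2) *: gL i p
           + ((2 * n)%:R - c + 2) *: ((eta i p)^T *m eta i p))
    & (0 < n)%N -> (is_einstein gL <-> c = (2 * n + 2)%:R)].
Proof.
split.
- exact: lift_eta_einstein omega_dtau kahler_einstein.
- exact: lift_ricci kahler tau_form omega_dtau kahler_einstein.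
move=> n0; rewrite natrD.
apply: (lift_einstein kahler tau_form omega_dtau kahler_einstein).
by rewrite muln_gt0.
Qed.
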